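(* Let $k$ be an algebraically closed field of characteristic zero, $G$ a finite group and $A\subseteq G$ an abelian subgroup. Let $(K,\{V_\lambda\mid\lambda\in A^*\})$ be a dynamical datum for $(G,A)$ and let $J:A^*\to k[G]\otimes k[G]$ be the function obtained from it by the exchange construction described in the context. Then $J(\lambda)$ is a dynamical twist for $k[G]$. Moreover, two isomorphic dynamical data $(K,\{V_\lambda\mid\lambda\in A^*\})$ and $(K',\{V'_\lambda\mid\lambda\in A^*\})$ define (by the exchange construction) the same gauge equivalence class of dynamical twists.
   Context: Conventions. $A^*=\mathrm{Hom}(A,k^\times)$ is written additively, with $0$ the trivial character. For $\mu\in A^*$ let $P_\mu=\frac1{|A|}\sum_{a\in A}\mu(a)^{-1}a\in k[A]$, and for a left $k[G]$-module $X$ let $X[\mu]=\{x\in X\mid ax=\mu(a)x \text{ for all } a\in A\}$. $\Delta,\varepsilon$ are the comultiplication $g\mapsto g\otimes g$ and counit $g\mapsto 1$ of $k[G]$. An element of $k[G]^{\otimes n}$ has zero weight if it commutes with $a\otimes\cdots\otimes a$ for all $a\in A$. Dynamical twists. A dynamical twist is a function $J:A^*\to k[G]\otimes k[G]$ with invertible zero weight values such that for all $\lambda\in A^*$: $(\Delta\otimes\mathrm{id})(J(\lambda))\cdot\sum_{\mu\in A^*}J(\lambda-\mu)\otimes P_\mu=(\mathrm{id}\otimes\Delta)(J(\lambda))\cdot(1\otimes J(\lambda))$ and $(\varepsilon\otimes\mathrm{id})J(\lambda)=(\mathrm{id}\otimes\varepsilon)J(\lambda)=1$. A gauge transformation is a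 function $t:A^*\to k[G]$ with invertible zero weight values and $\varepsilon(t(\lambda))=1$ for all $\lambda$; then $J^t(\lambda)=\Delta(t(\lambda)^{-1})J(\lambda)\bigl(\sum_{\mu}t(\lambda-\mu)\otimes P_\mu\bigr)(1\otimes t(\lambda))$ is again a dynamical twist, said to be gauge equivalent to $J$. Projective representations and dynamical data. A projective representation of a group $K$ on a vector space $V\neq0$ with 2-cocycle $c:K\times K\to k^\times$ is a map $\pi:K\to GL(V)$ with $\pi(g)\pi(h)=c(g,h)\pi(gh)$. It is linear if $c\equiv1$, and irreducible if $\pi(K)$ spans $\mathrm{End}_kV$. Tensor products are formed in the obvious way and $V^*$ carries the dual projective representation $g\mapsto(\pi(g)^{-1})^*$. A projective isomorphism from $\pi:K\to GL(V)$ to $\pi':K\to GL(V')$ is a linear isomorphism $\phi:V\to V'$ with $\pi'(g)\phi=\alpha(g)\phi\pi(g)$ for a function $\alpha:K\to k^\times$, called its multiplier function. A dynamical datum for $(G,A)$ is a subgroup $K\subseteq G$ with a family of irreducible projective representations $\pi_\lambda:K\to GL(V_\lambda)$, $\lambda\in A^*$, such that for all $\lambda,\mu\in A^*$ the projective representation $V_{\lambda-\mu}\otimes V_\lambda^*$ is linear and $\mathrm{Ind}_K^G(V_\lambda\otimes V_{\lambda-\mu}^* )\cong\mathrm{Ind}_A^G\mu$. An isomorphism of dynamical data $(K,\{V_\lambda\})\to(K',\{V'_\lambda\})$ is an element $g\in G$ with $gKg^{-1}=K'$ together with projective isomorphisms $\phi_\lambda:V_\lambda\to V'_\lambda$ ($\lambda\in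 A^*$) from $\pi_\lambda$ to $\pi'_\lambda\circ\mathrm{Ad}_g$ all having the same multiplier function. Exchange construction. Let $(K,\{V_\lambda\})$ be a dynamical datum. All $\pi_\lambda$ have the same 2-cocycle $c$; let $\widehat K$ be the corresponding central extension of $K$ by a subgroup $L\subset k^\times$ containing the values of $c$, with product $(g,x)(h,y)=(gh,c(g,h)xy)$, so that each $V_\lambda$ is a linear representation of $\widehat K$ via $(g,x)\mapsto x\pi_\lambda(g)$, and every $G$-module is a $\widehat K$-module with $L$ acting trivially. Choose $G$-isomorphisms $\epsilon_{\lambda\mu}:\mathrm{Ind}_K^G(V_\lambda\otimes V_{\lambda-\mu}^* )\cong\mathrm{Ind}_A^G\mu$. For every $G$-module $X$ they give isomorphisms $\mathrm{Hom}_{\widehat K}(V_\lambda,V_{\lambda-\mu}\otimes X)\cong\mathrm{Hom}_K(V_\lambda\otimes V_{\lambda-\mu}^*,X)\cong\mathrm{Hom}_G(\mathrm{Ind}_A^G\mu,X)\cong X[\mu]$ (first and third canonical, second via Frobenius reciprocity and $\epsilon_{\lambda\mu}$); let $\Psi(\lambda,x)\in\mathrm{Hom}_{\widehat K}(V_\lambda,V_{\lambda-\mu}\otimes X)$ correspond to $x\in X[\mu]$. The $\epsilon_{\lambda0}$ are normalized so that for the trivial module $X=k$ one has $\Psi(\lambda,1)=\mathrm{id}_{V_\lambda}$. For $G$-modules $X,Y$ let $J_{Y,X}(\lambda):Y\otimes X\to Y\otimes X$ be the linear operator with $(\Psi(\lambda-\mu,y)\otimes\mathrm{id})\circ\Psi(\lambda,x)=\Psi(\lambda,J_{Y,X}(\lambda)(y\otimes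 x))$ for all $x\in X[\mu],\,y\in Y[\nu]$, $\mu,\nu\in A^*$. These operators are natural in $X,Y$, hence given by the action of an element $J(\lambda)\in k[G]\otimes k[G]$; this is the function $J$ obtained from the datum (it depends on the choice of the $\epsilon_{\lambda\mu}$). *)

(* Defs.v *)
From HB Require Import structures.
From mathcomp Require Import all_boot all_order all_algebra all_fingroup all_field.
From mathcomp Require Import cyclic mxrepresentation mxtens.

Set Implicit Arguments.
Unset Strict Implicit.
Unset Printing Implicit Defensive.

Import GroupScope GRing.Theory.
Local Open Scope ring_scope.

(* The group G is the finGroupType gT itself.
   [galg k H] is k[H] with the convolution product.  It is kept distinct from
   {ffun H -> k}, whose library ring structure is pointwise.  The algebras
   k[G] (x) k[G] and k[G] (x) k[G] (x) k[G] are taken to be k[G * G] and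
   k[G * G * G], the pure tensor g (x) h being the basis element (g, h). *)
Definition galg (k : fieldType) (H : finGroupType) : Type := {ffun H -> k^o}.

Section GroupAlgebra.
Variables (k : fieldType) (H : finGroupType).
Implicit Types u v w : galg k H.

HB.instance Definition _ := Choice.on (galg k H).
HB.instance Definition _ := Vector.copy (galg k H) {ffun H -> k^o}.

Definition galg_coef (u : galg k H) : H -> k := (u : {ffun H -> k^o}).

Definition gelt (h : H) : galg k H := [ffun x => (x == h)%:R].

Definition galg_mul u v : galg k H :=
  [ffun x => \sum_(h : H) galg_coef u h * galg_coef v (h^-1 * x)%g].

Fact galg_mulA : associative galg_mul.
Proof.
move=> u v w; apply/ffunP=> x; rewrite !ffunE /galg_coef.
under eq_bigr => h _ do rewrite ffunE mulr_sumr.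
under [RHS]eq_bigr => h _ do rewrite ffunE mulr_suml.
rewrite [RHS]exchange_big /=; apply: eq_bigr => h _.
rewrite [RHS](reindex_inj (mulgI h)) /=; apply: eq_bigr => j _.
by rewrite /galg_coef mulKg invMg !mulgA mulrA.
Qed.

Fact galg_mul1r : left_id (gelt 1%g) galg_mul.
Proof.
move=> u; apply/ffunP=> x; rewrite !ffunE /galg_coef (bigD1 1%g) //= big1.
  by rewrite ffunE eqxx mul1r invg1 mul1g addr0.
by move=> h /negPf nh; rewrite ffunE nh mul0r.
Qed.

Fact galg_mulr1 : right_id (gelt 1%g) galg_mul.
Proof.
move=> u; apply/ffunP=> x; rewrite !ffunE /galg_coef (bigD1 x) //= big1.
  by rewrite ffunE mulVg eqxx mulr1 addr0.
move=> h nh; rewrite ffunE -eq_mulVg1.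
by rewrite (negPf nh) mulr0.
Qed.

Fact galg_mulDl : left_distributive galg_mul +%R.
Proof.
move=> u v w; apply/ffunP=> x; rewrite !ffunE -big_split /=.
by apply: eq_bigr => h _; rewrite /galg_coef ffunE mulrDl.
Qed.

Fact galg_mulDr : right_distributive galg_mul +%R.
Proof.
move=> u v w; apply/ffunP=> x; rewrite !ffunE -big_split /=.
by apply: eq_bigr => h _; rewrite /galg_coef ffunE mulrDr.
Qed.

Fact galg_1_neq0 : gelt 1%g != 0.
Proof. by apply/eqP => /ffunP/(_ 1%g)/eqP; rewrite !ffunE eqxx oner_eq0. Qed.

HB.instance Definition _ := GRing.Zmodule_isNzRing.Build (galg k H)
  galg_mulA galg_mul1r galg_mulr1 galg_mulDl galg_mulDr galg_1_neq0.

Fact galg_scaleAl (c : k) u v : c *: (u * v) = (c *: u) * v.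
Proof.
apply/ffunP=> x; rewrite !ffunE scaler_sumr.
by apply: eq_bigr => h _; rewrite /galg_coef ffunE scalerAl.
Qed.

HB.instance Definition _ :=
  GRing.Lmodule_isLalgebra.Build k (galg k H) galg_scaleAl.

Fact galg_scaleAr (c : k) u v : c *: (u * v) = u * (c *: v).
Proof.
apply/ffunP=> x; rewrite !ffunE scaler_sumr.
by apply: eq_bigr => h _; rewrite /galg_coef ffunE scalerAr.
Qed.

HB.instance Definition _ :=
  GRing.Lalgebra_isAlgebra.Build k (galg k H) galg_scaleAr.

(* Provides _^-1 and GRing.unit on k[H]. *)
HB.instance Definition _ := Algebra_isFalgebra.Build k (galg k H).

End GroupAlgebra.

Arguments gelt {k H} h.

(* Linear extension of a map f : H1 -> H2. *)
Definition galg_map (k : fieldType) (H1 H2 : finGroupType) (f : H1 -> H2)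
    (u : galg k H1) : galg k H2 :=
  \sum_(h : H1) galg_coef u h *: gelt (f h).

Definition galg_tens (k : fieldType) (H1 H2 : finGroupType)
    (u : galg k H1) (v : galg k H2) : galg k (H1 * H2)%type :=
  \sum_(h1 : H1) \sum_(h2 : H2)
     (galg_coef u h1 * galg_coef v h2) *: gelt (h1, h2).

Definition galg_act (k : fieldType) (H : finGroupType) n (r : H -> 'M[k]_n)
    (u : galg k H) : 'M[k]_n :=
  \sum_(h : H) galg_coef u h *: r h.

(* The dual group Hom(A, k^x), whose elements are extended by 0 outside A. *)
Section DualGroup.
Variables (k : closedFieldType) (gT : finGroupType) (A : {group gT}).

Definition is_char (f : {ffun gT -> k}) : bool :=
  [&& f 1%g == 1,
      [forall a in A, forall b in A, f (a * b)%g == f a * f b]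
    & [forall a, (a \notin A) ==> (f a == 0)]].

Record dualgroup := DualGroup {
  char_fun : {ffun gT -> k};
  _ : is_char char_fun }.

HB.instance Definition _ := [isSub for char_fun].
HB.instance Definition _ := [Choice of dualgroup by <:].

Definition char_val (mu : dualgroup) (a : gT) : k := char_fun mu a.
Coercion char_val : dualgroup >-> Funclass.

Implicit Types mu nu : dualgroup.

Lemma dual_char1 mu : mu 1%g = 1.
Proof. by have /and3P[/eqP] := valP mu. Qed.

Lemma dual_charM mu : {in A &, {morph mu : a b / (a * b)%g >-> a * b}}.
Proof.
have /and3P[_ /forall_inP fM _] := valP mu => a b Aa Ab.
by have /forall_inP/(_ b Ab)/eqP := fM a Aa.
Qed.

Lemma dual_char_out mu a : a \notin A -> mu a = 0.
Proof. by have /and3P[_ _ /forallP/(_ a)/implyP f0] := valP mu => /f0/eqP. Qed.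

Lemma dual_char_neq0 mu a : a \in A -> mu a != 0.
Proof.
move=> Aa; apply/eqP=> mua0; have := oner_neq0 k.
by rewrite -(dual_char1 mu) -(mulgV a) dual_charM ?groupV // mua0 mul0r eqxx.
Qed.

Lemma dual_char_eq mu nu : (forall a, mu a = nu a) -> mu = nu.
Proof. by move=> e; apply/val_inj/ffunP. Qed.

Fact is_char0 : is_char [ffun a => (a \in A)%:R].
Proof.
apply/and3P; split; first by rewrite ffunE group1.
  apply/forall_inP=> a Aa; apply/forall_inP=> b Ab.
  by rewrite !ffunE Aa Ab groupM // mulr1.
by apply/forallP=> a; apply/implyP=> /negPf nAa; rewrite ffunE nAa.
Qed.

Fact is_charD mu nu : is_char [ffun a => mu a * nu a].
Proof.
apply/and3P; split; first by rewrite ffunE !dual_char1 mulr1.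
  apply/forall_inP=> a Aa; apply/forall_inP=> b Ab.
  by rewrite !ffunE !dual_charM // mulrACA.
by apply/forallP=> a; apply/implyP=> nAa; rewrite ffunE dual_char_out // mul0r.
Qed.

Fact is_charN mu : is_char [ffun a => (mu a)^-1].
Proof.
apply/and3P; split; first by rewrite ffunE dual_char1 invr1.
  apply/forall_inP=> a Aa; apply/forall_inP=> b Ab.
  by rewrite !ffunE dual_charM // invfM.
by apply/forallP=> a; apply/implyP=> nAa; rewrite ffunE dual_char_out // invr0.
Qed.

Definition dual_zero : dualgroup := DualGroup is_char0.
Definition dual_add mu nu : dualgroup := DualGroup (is_charD mu nu).
Definition dual_opp mu : dualgroup := DualGroup (is_charN mu).

Fact dual_addA : associative dual_add.
Proof.
move=> x y z; apply: dual_char_eq => a.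
by rewrite /char_val !ffunE /char_val !ffunE mulrA.
Qed.

Fact dual_addC : commutative dual_add.
Proof.
by move=> x y; apply: dual_char_eq => a; rewrite /char_val !ffunE mulrC.
Qed.

Fact dual_add0 : left_id dual_zero dual_add.
Proof.
move=> x; apply: dual_char_eq => a; rewrite {1}/char_val ffunE.
rewrite {1}/char_val ffunE.
by case: (boolP (a \in A)) => [_|/dual_char_out ->]; rewrite ?mul1r ?mulr0.
Qed.

Fact dual_addN : left_inverse dual_zero dual_opp dual_add.
Proof.
move=> x; apply: dual_char_eq => a; rewrite {1}/char_val ffunE.
rewrite {1}/char_val ffunE /char_val /= ffunE; case: (boolP (a \in A)) => [Aa|nAa].
  by rewrite mulVf // dual_char_neq0.
by rewrite -/(char_val x a) dual_char_out // mulr0.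
Qed.

HB.instance Definition _ := GRing.isZmodule.Build dualgroup
  dual_addA dual_addC dual_add0 dual_addN.

(* Finiteness: the values on A are #|A|-th roots of unity. *)
Definition dual_roots : seq k :=
  sval (closed_field_poly_normal ('X^#|A| - 1 : {poly k})).

Lemma dual_rootsP mu a : a \in A -> mu a \in dual_roots.
Proof.
move=> Aa; have muX n : mu (a ^+ n)%g = mu a ^+ n.
  elim: n => [|n IHn]; first by rewrite expg0 expr0 dual_char1.
  by rewrite expgS exprS dual_charM ?groupX // IHn.
have : root ('X^#|A| - 1 : {poly k}) (mu a).
  by rewrite /root !hornerE -muX expg_cardG // dual_char1 subrr.
rewrite /dual_roots; case: closed_field_poly_normal => r /= e.
rewrite e rootZ ?root_prod_XsubC // lead_coef_eq0.
by rewrite -size_poly_eq0 size_XnsubC ?cardG_gt0.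
Qed.

Definition dual_code mu : {ffun gT -> option (seq_sub dual_roots)} :=
  [ffun a => insub (mu a)].

Definition dual_decode (f : {ffun gT -> option (seq_sub dual_roots)}) :
    option dualgroup :=
  insub [ffun a => oapp val 0 (f a)].

Lemma dual_codeK : pcancel dual_code dual_decode.
Proof.
move=> mu; rewrite /dual_decode.
have -> : [ffun a => oapp val 0 (dual_code mu a)] = val mu.
  apply/ffunP=> a; rewrite !ffunE.
  case: insubP => [z _ e|/=]; first exact: e.
  have [Aa /negP[] | nAa _] := boolP (a \in A); first exact: dual_rootsP.
  by rewrite -/(char_val mu a) dual_char_out.
by rewrite valK.
Qed.

HB.instance Definition _ : isCountable dualgroup := PCanIsCountable dual_codeK.
HB.instance Definition _ : isFinite dualgroup := PCanIsFinite dual_codeK.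

End DualGroup.

Section Twists.
Variables (k : closedFieldType) (gT : finGroupType) (A : {group gT}).
Local Notation kG := (galg k gT).
Local Notation kGG := (galg k (gT * gT)%type).
Local Notation dual := (dualgroup k A).

Definition Pproj (mu : dual) : kG :=
  (#|A|%:R)^-1 *: \sum_(a in A) (mu a)^-1 *: gelt a.

Definition counit (u : kG) : k := \sum_(g : gT) galg_coef u g.

Definition zero_weight1 (u : kG) : Prop :=
  {in A, forall a, gelt a * u = u * gelt a}.

Definition zero_weight2 (u : kGG) : Prop :=
  {in A, forall a, gelt (a, a) * u = u * gelt (a, a)}.

Definition comul : kG -> kGG := galg_map (fun g => (g, g)).
Definition one_tens1 : kG -> kGG := galg_map (fun g => (1%g, g)).
Definition comul_id : kGG -> galg k (gT * gT * gT)%type :=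
  galg_map (fun p => (p.1, p.1, p.2)).
Definition id_comul : kGG -> galg k (gT * gT * gT)%type :=
  galg_map (fun p => (p.1, p.2, p.2)).
Definition one_tens2 : kGG -> galg k (gT * gT * gT)%type :=
  galg_map (fun p => (1%g, p.1, p.2)).
Definition counit_id : kGG -> kG := galg_map snd.
Definition id_counit : kGG -> kG := galg_map fst.

Definition dynamical_twist (J : dual -> kGG) : Prop :=
  forall l : dual,
  [/\ J l \is a GRing.unit,
      zero_weight2 (J l),
      comul_id (J l) * \sum_(mu : dual) galg_tens (J (l - mu)) (Pproj mu)
        = id_comul (J l) * one_tens2 (J l),
      counit_id (J l) = 1
    & id_counit (J l) = 1].

Definition gauge_transformation (t : dual -> kG) : Prop :=
  forall l : dual,
  [/\ t l \is a GRing.unit, zero_weight1 (t l) & counit (t l) = 1].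

Definition gauge_act (t : dual -> kG) (J : dual -> kGG) (l : dual) : kGG :=
  comul (t l)^-1 * J l * (\sum_(mu : dual) galg_tens (t (l - mu)) (Pproj mu))
    * one_tens1 (t l).

Definition gauge_equivalent (J J' : dual -> kGG) : Prop :=
  exists2 t, gauge_transformation t & forall l, J' l = gauge_act t J l.

End Twists.

(* Vectors are columns, so a matrix representation is a left module.  Maps out
   of a subgroup K are functions on gT of which only the values on K matter. *)
Section ProjectiveRepresentations.
Variables (k : fieldType) (gT : finGroupType).

Definition proj_repr (K : {set gT}) n (c : gT -> gT -> k)
    (pi : gT -> 'M[k]_n) : Prop :=
  [/\ (0 < n)%N,
      {in K, forall g, pi g \in unitmx},
      {in K &, forall g h, c g h != 0}
    & {in K &, forall g h, pi g *m pi h = c g h *: pi (g * h)%g}].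

Definition proj_linear (K : {set gT}) n (pi : gT -> 'M[k]_n) : Prop :=
  proj_repr K (fun _ _ => 1) pi.

Definition proj_irreducible (K : {set gT}) n (pi : gT -> 'M[k]_n) : Prop :=
  (<<[seq pi g | g <- enum K]>> = fullv)%VS.

Definition tens_proj n1 n2 (pi1 : gT -> 'M[k]_n1) (pi2 : gT -> 'M[k]_n2) :
    gT -> 'M[k]_(n1 * n2) :=
  fun g => pi1 g *t pi2 g.

(* The dual space is 'cV_n through the dual basis. *)
Definition dual_proj n (pi : gT -> 'M[k]_n) : gT -> 'M[k]_n :=
  fun g => (invmx (pi g))^T.

Definition proj_iso (K : {set gT}) n n' (pi : gT -> 'M[k]_n)
    (pi' : gT -> 'M[k]_n') (alpha : gT -> k) (phi : 'M[k]_(n', n)) : Prop :=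
  [/\ exists2 psi : 'M[k]_(n, n'), phi *m psi = 1%:M & psi *m phi = 1%:M,
      {in K, forall g, alpha g != 0}
    & {in K, forall g, pi' g *m phi = alpha g *: (phi *m pi g)}].

End ProjectiveRepresentations.

(* Ind_K^G W = k[G] (x)_{k[K]} W, realised as the functions f : G -> W with
   f (g h) = h^-1 f(g) for h in K, with f standing for the sum of
   g (x) f(g) over representatives g of the cosets g K. *)
Section Induction.
Variables (k : fieldType) (gT : finGroupType) (K : {group gT}).
Variables (n : nat) (rho : gT -> 'M[k]_n).

Definition ind_pred : {pred {ffun gT -> 'cV[k]_n}} :=
  fun f => [forall g, forall h in K, f (g * h)%g == rho h^-1%g *m f g].

Record ind := Ind { ind_fun : {ffun gT -> 'cV[k]_n}; _ : ind_fun \in ind_pred }.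

Fact ind_predP (f : {ffun gT -> 'cV[k]_n}) :
  reflect (forall g h, h \in K -> f (g * h)%g = rho h^-1%g *m f g)
          (f \in ind_pred).
Proof.
apply: (iffP forallP) => [fP g h Kh | fP g].
  by have /forall_inP/(_ h Kh)/eqP := fP g.
by apply/forall_inP=> h Kh; rewrite fP.
Qed.

Fact ind_submod_closed : submod_closed ind_pred.
Proof.
split=> [|a u v /ind_predP uP /ind_predP vP]; apply/ind_predP=> g h Kh.
  by rewrite !ffunE mulmx0.
by rewrite !ffunE uP // vP // mulmxDr scalemxAr.
Qed.

HB.instance Definition _ := GRing.isSubmodClosed.Build k _ ind_pred
  ind_submod_closed.
HB.instance Definition _ := [isSub for ind_fun].
HB.instance Definition _ := [Choice of ind by <:].
HB.instance Definition _ := [SubChoice_isSubLmodule of ind by <:].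

Fact ind_act_subproof (g : gT) (f : ind) :
  [ffun x => ind_fun f (g^-1 * x)%g] \in ind_pred.
Proof.
case: f => f /= /ind_predP fP; apply/ind_predP=> x h Kh.
by rewrite !ffunE mulgA fP.
Qed.

Definition ind_act (g : gT) (f : ind) : ind := Ind (ind_act_subproof g f).

(* The canonical K-map W -> Ind_K^G W, w |-> 1 (x) w. *)
Hypothesis rho_linear : proj_linear K rho.

Fact ind_unit_subproof (w : 'cV[k]_n) :
  [ffun x => if x \in K then rho x^-1%g *m w else 0] \in ind_pred.
Proof.
have [_ _ _ rhoM] := rho_linear.
apply/ind_predP=> g h Kh; rewrite !ffunE groupMr //; case: ifP => Kg.
  by rewrite invMg mulmxA rhoM ?groupV // scale1r.
by rewrite mulmx0.
Qed.

Definition ind_unit (w : 'cV[k]_n) : ind := Ind (ind_unit_subproof w).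

End Induction.

Arguments ind {k gT} K {n} rho.
Arguments ind_unit {k gT K n rho} rho_linear w.

Definition ind_iso (k : fieldType) (gT : finGroupType) (K L : {group gT}) n m
    (rho : gT -> 'M[k]_n) (sigma : gT -> 'M[k]_m)
    (f : {linear ind K rho -> ind L sigma}) : Prop :=
  bijective f /\ forall g v, f (ind_act g v) = ind_act g (f v).

(* Frobenius reciprocity: the G-map Ind_K^G W -> X extending the K-map f.
   Averaging over G amounts to summing over coset representatives. *)
Definition frob_ext (k : fieldType) (gT : finGroupType) (K : {group gT}) n m
    (rho : gT -> 'M[k]_n) (rX : mx_representation k [set: gT] m)
    (f : 'cV[k]_n -> 'cV[k]_m) (v : ind K rho) : 'cV[k]_m :=
  (#|K|%:R)^-1 *: \sum_(g : gT) rX g *m f (ind_fun v g).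

Section GModules.
Variables (k : fieldType) (gT : finGroupType).

Fact triv_mx_repr : mx_repr [set: gT] (fun _ : gT => 1%:M : 'M[k]_1).
Proof. by split=> // g h _ _; rewrite mulmx1. Qed.
Definition triv_repr : mx_representation k [set: gT] 1 :=
  MxRepresentation triv_mx_repr.

Variables (m n : nat) (rY : mx_representation k [set: gT] m)
  (rX : mx_representation k [set: gT] n).

Fact tens_mx_repr : mx_repr [set: gT] (fun g => rY g *t rX g).
Proof.
split=> [|g h _ _]; last by rewrite !repr_mxM ?inE // tensmx_mul.
rewrite !repr_mx1; apply/matrixP=> i j.
case: (mxtens_indexP i) => i0 i1; case: (mxtens_indexP j) => j0 j1.
rewrite tensmxE !mxE -natrM mulnb; congr (_%:R); congr nat_of_bool.
by rewrite -xpair_eqE (can_eq (@mxtens_indexK _ _)).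
Qed.
Definition tens_repr : mx_representation k [set: gT] (m * n) :=
  MxRepresentation tens_mx_repr.

End GModules.

Section DynamicalData.
Variables (k : closedFieldType) (gT : finGroupType) (A : {group gT}).
Local Notation dual := (dualgroup k A).

Definition char_mx (mu : dual) : gT -> 'M[k]_1 := fun a => (mu a)%:M.

Definition weight_space n (rX : mx_representation k [set: gT] n) (mu : dual)
    (x : 'cV[k]_n) : Prop :=
  {in A, forall a, rX a *m x = mu a *: x}.

Record dyn_datum := DynDatum {
  dd_group :> {group gT};
  dd_dim : dual -> nat;
  dd_rep : forall l : dual, gT -> 'M[k]_(dd_dim l);
  dd_proj : forall l, exists c, proj_repr dd_group c (dd_rep l);
  dd_irr : forall l, proj_irreducible dd_group (dd_rep l);
  dd_linear : forall l mu,
    proj_linear dd_group (tens_proj (dd_rep (l - mu)) (dual_proj (dd_rep l)));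
  dd_ind : forall l mu,
    exists f : {linear
        ind dd_group (tens_proj (dd_rep l) (dual_proj (dd_rep (l - mu)))) ->
        ind A (char_mx mu)},
      ind_iso f }.

Definition dd_isomorphic (D D' : dyn_datum) : Prop :=
  exists g : gT,
    [set (g * h * g^-1)%g | h in D] = D' :> {set gT} /\
    exists alpha : gT -> k, forall l, exists phi,
      proj_iso D (dd_rep D l) (fun h => dd_rep D' l (g * h * g^-1)%g) alpha phi.

(* V_l (x) V_kappa^* as a representation of K. *)
Definition dd_hom (D : dyn_datum) (l kappa : dual) :=
  tens_proj (dd_rep D l) (dual_proj (dd_rep D kappa)).

Fact dd_hom_linear (D : dyn_datum) (l kappa : dual) :
  proj_linear D (dd_hom D l kappa).
Proof. by have := dd_linear D kappa (kappa - l); rewrite subKr. Qed.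

(* The isomorphisms eps_{l,mu}, indexed by (l, kappa) with kappa = l - mu:
   V_{l - mu - nu} and V_{l - (mu + nu)} then need no transport. *)
Definition eps_family (D : dyn_datum) : Type :=
  forall l kappa : dual,
    {linear ind D (dd_hom D l kappa) -> ind A (char_mx (l - kappa))}.

Section Exchange.
Variables (D : dyn_datum) (eps : eps_family D).

(* The image of x in X[l - kappa] = Hom_A(l - kappa, X) in
   Hom_K(V_l (x) V_kappa^*, X). *)
Definition Psi_curried n (rX : mx_representation k [set: gT] n)
    (l kappa : dual) (x : 'cV[k]_n) (w : 'cV[k]_(dd_dim D l * dd_dim D kappa)) :
    'cV[k]_n :=
  frob_ext rX (fun z : 'cV[k]_1 => z 0 0 *: x)
    (eps l kappa (ind_unit (dd_hom_linear D l kappa) w)).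

(* Psi(l, x) : V_l -> V_kappa (x) X for x in X[l - kappa]: with e_i the basis
   of V_kappa and f_i the dual basis, v is sent to the sum of
   e_i (x) Psi_curried (v (x) f_i).  It commutes with the central extension of
   K because Psi_curried is K-linear. *)
Definition Psi n (rX : mx_representation k [set: gT] n)
    (l kappa : dual) (x : 'cV[k]_n) : 'M[k]_(dd_dim D kappa * n, dd_dim D l) :=
  \sum_(i < dd_dim D kappa) \sum_(j < dd_dim D l)
    ((delta_mx i 0 : 'cV_(dd_dim D kappa))
       *t Psi_curried rX x ((delta_mx j 0 : 'cV_(dd_dim D l))
                               *t (delta_mx i 0 : 'cV_(dd_dim D kappa))))
      *m (delta_mx 0 j : 'rV_(dd_dim D l)).

(* The normalisation reads Psi(l, 1) v = v (x) 1 in V_l (x) k. *)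
Definition eps_normalized : Prop :=
  forall (l : dual) (v : 'cV[k]_(dd_dim D l)),
    Psi (triv_repr k gT) l l 1%:M *m v = v *t (1%:M : 'M[k]_1).

Definition exchange_choice : Prop :=
  (forall l kappa, ind_iso (eps l kappa)) /\ eps_normalized.

(* castmx is the associator (V (x) Y) (x) X -> V (x) (Y (x) X).  As Psi is
   meaningful on weight vectors only, the weight of J(l)(y (x) x) is part of
   the requirement. *)
Definition is_exchange (J : dual -> galg k (gT * gT)%type) : Prop :=
  forall m n (rY : mx_representation k [set: gT] m)
    (rX : mx_representation k [set: gT] n)
    (l mu nu : dual) (y : 'cV[k]_m) (x : 'cV[k]_n),
  weight_space rX mu x -> weight_space rY nu y ->
  let yx : 'cV[k]_(m * n) :=
    galg_act (fun p : gT * gT => rY p.1 *t rX p.2) (J l) *m (y *t x) in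
  weight_space (tens_repr rY rX) (mu + nu) yx /\
  castmx (esym (mulnA _ _ _), erefl)
    ((Psi rY (l - mu) (l - mu - nu) y *t (1%:M : 'M[k]_n))
       *m Psi rX l (l - mu) x)
  = Psi (tens_repr rY rX) l (l - mu - nu) yx.

End Exchange.

End DynamicalData.

(* Main.v *)
(** A dynamical datum is read as a family of matrices with entries in [k[G]]:
the intertwiners [Psi(l, x) : V_l -> V_kap (x) X] all come from one matrix
[T l kap], an element of [Hom(V_l, V_kap) (x) k[G]], acting on [x], and the
inverse of [eps] gives a matrix [S l kap] in the opposite direction.  Frobenius
reciprocity becomes two identities: [tr (S T) = P_(l - kap)], and
[T tr (S M) = M] for every [K]-equivariant matrix [M], over any algebra
receiving [k[G]].  Hence every equivariant [M] is [T x] for a unique [x] of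
weight [l - kap].

Applied to the composite [T_(kap,tau) T_(l,kap)] over [k[G] (x) k[G]] this
produces [J(l)]; uniqueness over [k[G]^(x)3] is the twist equation, and
uniqueness over [k[G]] gives the counit conditions.  Over the trivial module the
same statement is Schur's lemma, [d_kap S_(kap,tau) T_(kap',tau)] being
[P_(kap - tau)] or [0], so that traces of [S S T] form an inverse of [J(l)].
For isomorphic data, conjugating [T'] into [Hom(V_l, V_kap) (x) k[G]] yields an
equivariant matrix [T t], and the sums of these [t] over [kap] are the gauge
transformation. *)
From HB Require Import structures.
Require Import Defs.
From mathcomp Require Import all_boot all_order all_algebra all_fingroup all_field.
From mathcomp Require Import mxrepresentation mxtens.
Set Implicit Arguments.
Unset Strict Implicit.
Unset Printing Implicit Defensive.
Import GRing.Theory.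
Local Open Scope ring_scope.

(** * Group algebras and their morphisms *)

(** The operators J_{Y,X} are prescribed on all modules at once, but only on weight vectors, so
    [J l] must be recovered from partial data. Two devices do this. A module X enters Psi only
    through the action of elements of k[G], and an element of k[G] (x) k[G] is determined by its
    effect on 1 (x) 1 in the regular module; hence the exchange law is an identity between matrices
    over k[G] (x) k[G]. And identities are tested on the orthogonal idempotents P_nu (x) P_mu, whose
    sum is 1; this completeness rests on A being abelian and k algebraically closed. The two
    identities between S and T say that eps eps^-1 and eps^-1 eps are identities, evaluated on
    generators of the two induced modules. The second survives every base change k[G] -> B because
    it makes each product T_ij S_qp an explicit average over K of matrix coefficients. The base
    changes that occur are the identity, the counit, Delta and (Delta (x) id) Delta. *)

Section GroupAlgebraBasis.
Variables (k : fieldType) (H : finGroupType).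
Implicit Types u v : galg k H.

Lemma galg_coefD u v h : galg_coef (u + v) h = galg_coef u h + galg_coef v h.
Proof. by rewrite /galg_coef ffunE. Qed.

Lemma galg_coefZ a u h : galg_coef (a *: u) h = a * galg_coef u h.
Proof. by rewrite /galg_coef ffunE. Qed.

Lemma galg_coef0 h : galg_coef (0 : galg k H) h = 0.
Proof. by rewrite /galg_coef ffunE. Qed.

Lemma galg_coef_sum I (r : seq I) (P : pred I) (F : I -> galg k H) h :
  galg_coef (\sum_(i <- r | P i) F i) h = \sum_(i <- r | P i) galg_coef (F i) h.
Proof.
by apply: (big_morph (fun u => galg_coef u h)) => [u v|];
   rewrite ?galg_coefD ?galg_coef0.
Qed.

Lemma galg_coef_gelt g h : galg_coef (gelt g : galg k H) h = (h == g)%:R.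
Proof. by rewrite /galg_coef ffunE. Qed.

Lemma galg_coefM u v x :
  galg_coef (u * v) x = \sum_h galg_coef u h * galg_coef v (h^-1 * x)%g.
Proof. by rewrite {1}/galg_coef ffunE. Qed.

Lemma galg_eqP u v : (forall h, galg_coef u h = galg_coef v h) -> u = v.
Proof. by move=> uv; apply/ffunP => h; apply: uv. Qed.

Lemma galgE u : u = \sum_h galg_coef u h *: gelt h.
Proof.
apply: galg_eqP => x; rewrite galg_coef_sum (bigD1 x) //= galg_coefZ.
rewrite galg_coef_gelt eqxx mulr1 big1 ?addr0 // => h nh.
by rewrite galg_coefZ galg_coef_gelt eq_sym (negPf nh) mulr0.
Qed.

Lemma gelt1 : gelt 1%g = 1 :> galg k H. Proof. by []. Qed.

Lemma geltM g h : gelt (g * h)%g = gelt g * gelt h :> galg k H.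
Proof.
apply: galg_eqP => x; rewrite galg_coefM (bigD1 g) //= !galg_coef_gelt eqxx mul1r.
rewrite big1 => [|i /negPf ni]; last by rewrite galg_coef_gelt ni mul0r.
by rewrite addr0 (can2_eq (mulKVg g) (mulKg g)).
Qed.

Lemma geltV g : gelt g * gelt g^-1%g = 1 :> galg k H.
Proof. by rewrite -geltM mulgV. Qed.

Lemma galg_coef_gelt_mul g u x : galg_coef (gelt g * u) x = galg_coef u (g^-1 * x)%g.
Proof.
rewrite galg_coefM (bigD1 g) //= galg_coef_gelt eqxx mul1r.
by rewrite big1 ?addr0 // => i /negPf ni; rewrite galg_coef_gelt ni mul0r.
Qed.

Lemma galg_coef_mul_gelt g u x : galg_coef (u * gelt g) x = galg_coef u (x * g^-1)%g.
Proof.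
rewrite galg_coefM (bigD1 (x * g^-1)%g) //= galg_coef_gelt invMg invgK mulgKV.
rewrite eqxx mulr1 big1 ?addr0 // => i ni; rewrite galg_coef_gelt.
case: eqP => [e|_]; last by rewrite mulr0.
by case/eqP: ni; rewrite -e invMg invgK mulKVg.
Qed.

Lemma galg_lin_eq (V : lmodType k) (f f' : {linear galg k H -> V}) :
  (forall h, f (gelt h) = f' (gelt h)) -> f =1 f'.
Proof.
move=> e u; rewrite (galgE u) !linear_sum; apply: eq_bigr => h _.
by rewrite !linearZ /= e.
Qed.

Lemma galg_commP (B : algType k) (f : {linear galg k H -> B}) b :
  (forall h, GRing.comm (f (gelt h)) b) -> forall u, GRing.comm (f u) b.
Proof.
move=> fb u; rewrite (galgE u) linear_sum /GRing.comm mulr_suml mulr_sumr.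
by apply: eq_bigr => h _; rewrite linearZ /= -scalerAl -scalerAr fb.
Qed.

End GroupAlgebraBasis.

Section GroupAlgebraMap.
Variables (k : fieldType) (H1 H2 : finGroupType) (f : H1 -> H2).

Fact galg_map_is_linear : linear (@galg_map k _ _ f).
Proof.
move=> a u v; rewrite /galg_map scaler_sumr -big_split /=.
by apply: eq_bigr => h _; rewrite galg_coefD galg_coefZ scalerDl scalerA.
Qed.
HB.instance Definition _ :=
  GRing.isLinear.Build k (galg k H1) (galg k H2) _ (galg_map f) galg_map_is_linear.

Lemma galg_map_gelt h : galg_map f (gelt h) = gelt (f h) :> galg k H2.
Proof.
rewrite /galg_map (bigD1 h) //= galg_coef_gelt eqxx scale1r.
by rewrite big1 ?addr0 // => i /negPf ni; rewrite galg_coef_gelt ni scale0r.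
Qed.

Lemma galg_map_monoid : {morph f : x y / (x * y)%g} ->
  monoid_morphism (@galg_map k _ _ f).
Proof.
move=> fM; have f1 : f 1%g = 1%g by apply: (mulgI (f 1%g)); rewrite -fM !mulg1.
split=> [|u v]; first by rewrite -gelt1 galg_map_gelt f1.
rewrite (galgE u) (galgE v) !linear_sum !mulr_suml linear_sum.
apply: eq_bigr => g _ /=; rewrite !mulr_sumr linear_sum; apply: eq_bigr => h _ /=.
rewrite -!scalerAl !linearZ /= -!scalerAl -!scalerAr !linearZ /=.
by rewrite -geltM !galg_map_gelt fM geltM.
Qed.

End GroupAlgebraMap.

Lemma galg_map_comp (k : fieldType) (H1 H2 H3 : finGroupType)
    (f : H2 -> H3) (g : H1 -> H2) (u : galg k H1) :
  galg_map f (galg_map g u) = galg_map (f \o g) u.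
Proof.
apply: (galg_lin_eq (f := galg_map f \o galg_map g)) => h /=.
by rewrite !galg_map_gelt.
Qed.

Section Morphisms.
Variables (k : closedFieldType) (gT : finGroupType).
Local Notation kG := (galg k gT).
Local Notation kGG := (galg k (gT * gT)%type).
Local Notation kGGG := (galg k (gT * gT * gT)%type).

Definition tens1_one : kG -> kGG := galg_map (fun g => (g, 1%g)).
Definition tens2_one : kGG -> galg k (gT * gT * gT)%type :=
  galg_map (fun p => (p.1, p.2, 1%g)).
(** The counit followed by the unit of k[G]. Keeping k[G] as target makes this an algebra morphism
    of the same kind as the others; it is also what [counit_id] does to the first tensor leg. *)
Definition counit_unit : kG -> kG := galg_map (fun=> 1%g).

HB.instance Definition _ := GRing.Linear.copy (@comul k gT) (galg_map _).
HB.instance Definition _ := GRing.Linear.copy tens1_one (galg_map _).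
HB.instance Definition _ := GRing.Linear.copy (@one_tens1 k gT) (galg_map _).
HB.instance Definition _ := GRing.Linear.copy tens2_one (galg_map _).
HB.instance Definition _ := GRing.Linear.copy (@one_tens2 k gT) (galg_map _).
HB.instance Definition _ := GRing.Linear.copy (@comul_id k gT) (galg_map _).
HB.instance Definition _ := GRing.Linear.copy (@id_comul k gT) (galg_map _).
HB.instance Definition _ := GRing.Linear.copy (@counit_id k gT) (galg_map _).
HB.instance Definition _ := GRing.Linear.copy (@id_counit k gT) (galg_map _).
HB.instance Definition _ := GRing.Linear.copy counit_unit (galg_map _).

Fact comul_monoid : monoid_morphism (@comul k gT).
Proof. by apply: galg_map_monoid. Qed.
Fact tens1_one_monoid : monoid_morphism tens1_one.
Proof. by apply: galg_map_monoid => x y; congr pair; rewrite mulg1. Qed.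
Fact one_tens1_monoid : monoid_morphism (@one_tens1 k gT).
Proof. by apply: galg_map_monoid => x y; congr pair; rewrite mulg1. Qed.
Fact tens2_one_monoid : monoid_morphism tens2_one.
Proof. by apply: galg_map_monoid => x y; congr pair; rewrite mulg1. Qed.
Fact one_tens2_monoid : monoid_morphism (@one_tens2 k gT).
Proof.
by apply: galg_map_monoid => x y; congr (pair (pair _ _) _); rewrite mulg1.
Qed.
Fact comul_id_monoid : monoid_morphism (@comul_id k gT).
Proof. by apply: galg_map_monoid. Qed.
Fact id_comul_monoid : monoid_morphism (@id_comul k gT).
Proof. by apply: galg_map_monoid. Qed.
Fact counit_id_monoid : monoid_morphism (@counit_id k gT).
Proof. by apply: galg_map_monoid. Qed.
Fact id_counit_monoid : monoid_morphism (@id_counit k gT).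
Proof. by apply: galg_map_monoid. Qed.
Fact counit_unit_monoid : monoid_morphism counit_unit.
Proof. by apply: galg_map_monoid => x y; rewrite mulg1. Qed.

HB.instance Definition _ :=
  GRing.isMonoidMorphism.Build kG kGG (@comul k gT) comul_monoid.
HB.instance Definition _ :=
  GRing.isMonoidMorphism.Build kG kGG tens1_one tens1_one_monoid.
HB.instance Definition _ :=
  GRing.isMonoidMorphism.Build kG kGG (@one_tens1 k gT) one_tens1_monoid.
HB.instance Definition _ :=
  GRing.isMonoidMorphism.Build kGG kGGG tens2_one tens2_one_monoid.
HB.instance Definition _ :=
  GRing.isMonoidMorphism.Build kGG kGGG (@one_tens2 k gT) one_tens2_monoid.
HB.instance Definition _ :=
  GRing.isMonoidMorphism.Build kGG kGGG (@comul_id k gT) comul_id_monoid.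
HB.instance Definition _ :=
  GRing.isMonoidMorphism.Build kGG kGGG (@id_comul k gT) id_comul_monoid.
HB.instance Definition _ :=
  GRing.isMonoidMorphism.Build kGG kG (@counit_id k gT) counit_id_monoid.
HB.instance Definition _ :=
  GRing.isMonoidMorphism.Build kGG kG (@id_counit k gT) id_counit_monoid.
HB.instance Definition _ :=
  GRing.isMonoidMorphism.Build kG kG counit_unit counit_unit_monoid.

Lemma galg_tensE (u v : kG) : galg_tens u v = tens1_one u * one_tens1 v.
Proof.
rewrite /tens1_one /one_tens1 [in RHS](galgE u) [in RHS](galgE v).
rewrite !linear_sum mulr_suml /galg_tens.
apply: eq_bigr => g _; rewrite mulr_sumr; apply: eq_bigr => h _.
rewrite !linearZ /= !galg_map_gelt -scalerAl -scalerAr scalerA -geltM.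
by congr (_ *: gelt (pair _ _)); rewrite ?mulg1 ?mul1g.
Qed.

Lemma comul_gelt g : comul (gelt g) = tens1_one (gelt g) * one_tens1 (gelt g) :> kGG.
Proof.
rewrite /comul /tens1_one /one_tens1 !galg_map_gelt -geltM.
by congr (gelt (pair _ _)); rewrite ?mulg1 ?mul1g.
Qed.

Lemma counit_unitE (u : kG) : counit_unit u = (counit u)%:A.
Proof.
rewrite /counit_unit /galg_map /counit scaler_suml.
by apply: eq_bigr => h _; rewrite gelt1.
Qed.

Lemma tens1_one_comm (u v : kG) : GRing.comm (tens1_one u) (one_tens1 v).
Proof.
apply: (galg_commP (f := tens1_one)) => g; apply: commr_sym => /=.
apply: (galg_commP (f := @one_tens1 k gT)) => h /=.
rewrite /= /GRing.comm /tens1_one /one_tens1 !galg_map_gelt -!geltM.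
by congr (gelt (pair _ _)); rewrite ?mulg1 ?mul1g.
Qed.

Lemma tens2_one_comm (u : kGG) (v : kG) :
  GRing.comm (tens2_one u) (one_tens2 (one_tens1 v)).
Proof.
apply: (galg_commP (f := tens2_one)) => g; apply: commr_sym.
apply: (galg_commP (f := @one_tens2 k gT \o @one_tens1 k gT)) => h /=.
rewrite /= /GRing.comm /tens2_one /one_tens2 /one_tens1 !galg_map_gelt -!geltM.
by congr (gelt (pair (pair _ _) _)); rewrite ?mulg1 ?mul1g.
Qed.

Lemma one_tens2_comm (u : kGG) (v : kG) :
  GRing.comm (one_tens2 u) (tens2_one (tens1_one v)).
Proof.
apply: (galg_commP (f := @one_tens2 k gT)) => g; apply: commr_sym.
apply: (galg_commP (f := tens2_one \o tens1_one)) => h /=.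
rewrite /= /GRing.comm /tens2_one /one_tens2 /tens1_one !galg_map_gelt -!geltM.
by congr (gelt (pair (pair _ _) _)); rewrite ?mulg1 ?mul1g.
Qed.

Lemma comul_id_tens1 (u : kG) : comul_id (tens1_one u) = tens2_one (comul u).
Proof. by rewrite /comul_id /tens1_one galg_map_comp /tens2_one /comul galg_map_comp. Qed.

Lemma comul_id_one_tens1 (u : kG) :
  comul_id (one_tens1 u) = one_tens2 (one_tens1 u).
Proof. by rewrite /comul_id /one_tens1 /one_tens2 !galg_map_comp. Qed.

Lemma id_comul_tens1 (u : kG) : id_comul (tens1_one u) = tens2_one (tens1_one u).
Proof. by rewrite /id_comul /tens1_one /tens2_one !galg_map_comp. Qed.

Lemma id_comul_one_tens1 (u : kG) : id_comul (one_tens1 u) = one_tens2 (comul u).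
Proof. by rewrite /id_comul /one_tens1 /one_tens2 /comul !galg_map_comp. Qed.

Lemma tens2_one_one_tens1 (u : kG) :
  tens2_one (one_tens1 u) = one_tens2 (tens1_one u).
Proof. by rewrite /tens2_one /one_tens1 /one_tens2 /tens1_one !galg_map_comp. Qed.

Lemma comulA (u : kG) : comul_id (comul u) = id_comul (comul u).
Proof. by rewrite /comul_id /id_comul /comul !galg_map_comp. Qed.

Lemma counit_id_tens1 (u : kG) : counit_id (tens1_one u) = counit_unit u.
Proof. by rewrite /counit_id /tens1_one /counit_unit !galg_map_comp. Qed.

Lemma counit_id_one_tens1 (u : kG) : counit_id (one_tens1 u) = u.
Proof.
rewrite /counit_id /one_tens1 galg_map_comp [RHS]galgE.
exact: eq_bigr.
Qed.

Lemma id_counit_tens1 (u : kG) : id_counit (tens1_one u) = u.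
Proof. by rewrite /id_counit /tens1_one galg_map_comp [RHS]galgE. Qed.

Lemma id_counit_one_tens1 (u : kG) : id_counit (one_tens1 u) = counit_unit u.
Proof. by rewrite /id_counit /one_tens1 /counit_unit !galg_map_comp. Qed.

Lemma counit_id_comul (u : kG) : counit_id (comul u) = u.
Proof. by rewrite /counit_id /comul galg_map_comp [RHS]galgE. Qed.

Lemma id_counit_comul (u : kG) : id_counit (comul u) = u.
Proof. by rewrite /id_counit /comul galg_map_comp [RHS]galgE. Qed.

End Morphisms.

(** * Weight projectors *)

Section WeightProjectors.
Variables (k : closedFieldType) (gT : finGroupType) (A : {group gT}).
Local Notation kG := (galg k gT).
Local Notation dual := (dualgroup k A).
Implicit Types (mu nu : dual).

(** This is the weight space X[s] of the module X = B, on which k[G] acts by left multiplication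
    through [phi]. *)
Definition has_weight (B : lalgType k) (phi : kG -> B) (s : dual) (x : B) :=
  {in A, forall a, phi (gelt a) * x = s a *: x}.

Lemma Pproj_gelt mu : {in A, forall a, Pproj mu * gelt a = mu a *: Pproj mu}.
Proof.
move=> a Aa; rewrite /Pproj -scalerAl scalerA mulrC -scalerA; congr (_ *: _).
rewrite mulr_suml scaler_sumr (reindex_inj (mulIg a^-1)%g) /=.
apply: eq_big => [b|b Ab]; first by rewrite groupMr ?groupV.
rewrite -scalerAl -geltM mulgKV scalerA; congr (_ *: _).
have Ab' : b \in A by rewrite -(groupMr _ (groupVr Aa)).
have -> : mu (b * a^-1)%g = mu b / mu a.
  apply: (canRL (mulfK (dual_char_neq0 mu Aa))).
  by rewrite -dual_charM // ?groupM ?groupV // mulgKV.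
by rewrite invfM invrK mulrC.
Qed.

Lemma gelt_Pproj mu : has_weight id mu (Pproj mu).
Proof.
move=> a Aa; rewrite /Pproj -scalerAr scalerA mulrC -scalerA; congr (_ *: _).
rewrite mulr_sumr scaler_sumr (reindex_inj (mulgI a^-1)%g) /=.
apply: eq_big => [b|b Ab]; first by rewrite groupMl ?groupV.
rewrite -scalerAr -geltM mulKVg scalerA; congr (_ *: _).
have Ab' : b \in A by rewrite -(groupMl _ (groupVr Aa)).
have -> : mu (a^-1 * b)%g = mu b / mu a.
  apply: (canRL (mulfK (dual_char_neq0 mu Aa))).
  by rewrite mulrC -dual_charM // ?groupM ?groupV // mulKVg.
by rewrite invfM invrK mulrC.
Qed.

Lemma dual_neqP mu nu : mu != nu -> exists2 a, a \in A & mu a != nu a.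
Proof.
move=> ne; case: (pickP (fun a => (a \in A) && (mu a != nu a))) => [a /andP[]|h].
  by exists a.
case/eqP: ne; apply: dual_char_eq => a; have := h a; case: (boolP (a \in A)) => /=.
  by move=> _ /negbFE/eqP.
by move=> nA _; rewrite !dual_char_out.
Qed.

(** Choose a in A separating the two characters and evaluate u phi(a) x in both ways. *)
Lemma has_weight_disjoint (B : algType k) (phi : kG -> B) mu nu (u v x y : B) :
    {in A, forall a, u * phi (gelt a) = mu a *: u} -> has_weight phi nu x ->
  mu != nu -> u * x = 0.
Proof.
move=> hu hx /dual_neqP[a Aa ne].
have : (mu a - nu a) *: (u * x) = 0.
  by rewrite scalerBl scalerAl -hu // -mulrA hx // -scalerAr subrr.
by move/eqP; rewrite scaler_eq0 subr_eq0 (negPf ne) /= => /eqP.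
Qed.

Lemma Pproj_orth mu nu : mu != nu -> Pproj mu * Pproj nu = 0.
Proof.
move=> ne; apply: (has_weight_disjoint (phi := id) 0 0 _ _ ne).
  exact: Pproj_gelt.
exact: gelt_Pproj.
Qed.

Hypothesis char0 : [pchar k] =i pred0.

Lemma natf_neq0_char0 n : (0 < n)%N -> n%:R != 0 :> k.
Proof. by move=> n0; rewrite (pcharf0P k).1 // -lt0n. Qed.

Lemma Pproj_weight (B : algType k) (phi : {linear kG -> B}) mu x :
  has_weight phi mu x -> phi (Pproj mu) * x = x.
Proof.
move=> hx; rewrite linearZ linear_sum /= -scalerAl mulr_suml.
transitivity (#|A|%:R^-1 *: \sum_(a in A) x).
  congr (_ *: _); apply: eq_bigr => a Aa.
  by rewrite linearZ /= -scalerAl hx // scalerA mulVf ?scale1r // dual_char_neq0.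
by rewrite sumr_const -scaler_nat scalerA mulVf ?scale1r // natf_neq0_char0.
Qed.

Lemma Pproj_idem mu : Pproj mu * Pproj mu = Pproj mu.
Proof. exact: (Pproj_weight (phi := idfun) (@gelt_Pproj mu)). Qed.

Lemma Pproj_mul mu nu : Pproj mu * Pproj nu = Pproj mu *+ (mu == nu).
Proof. by case: eqVneq => [->|/Pproj_orth //]; rewrite Pproj_idem. Qed.

Lemma counit_unit_Pproj mu : counit_unit (Pproj mu) = (mu == 0)%:R.
Proof.
have gt1 a : counit_unit (gelt a : kG) = 1.
  by rewrite /counit_unit galg_map_gelt.
have e (a : gT) : a \in A -> counit_unit (Pproj mu) = mu a *: counit_unit (Pproj mu).
  move=> Aa; rewrite -linearZ /= -gelt_Pproj // rmorphM /= gt1.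
  by rewrite mul1r.
case: eqVneq => [->|/dual_neqP[a Aa ne]].
  rewrite linearZ linear_sum /=.
  rewrite (eq_bigr (fun=> 1)) => [|a Aa].
    by rewrite sumr_const -scaler_nat scalerA mulVf ?scale1r // natf_neq0_char0.
  by rewrite linearZ /= gt1 /char_val /= ffunE Aa invr1 scale1r.
have /eqP : (mu a - 1) *: counit_unit (Pproj mu) = 0.
  by rewrite scalerBl scale1r -e // subrr.
rewrite scaler_eq0 subr_eq0.
by move: ne; rewrite {2}/char_val /= ffunE Aa => /negPf-> /eqP.
Qed.

(** Applying the factors f - r one after the other to y, the last value before the first zero is an
    eigenvector. The predicate [Q] keeps the search inside a subset stable under these factors. *)
Lemma eigenvector_of_annihilator (V : lmodType k) (f : V -> V)
    (Q : V -> Prop) (rs : seq k) (y : V) :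
    (forall r z, Q z -> Q (f z - r *: z)) -> Q y -> y != 0 ->
    foldr (fun r z => f z - r *: z) y rs = 0 ->
  exists z, [/\ Q z, z != 0 & exists r, f z = r *: z].
Proof.
move=> Qf Qy y0; elim: rs => [/= /eqP|r rs IH /=]; first by rewrite (negPf y0).
have [//|nz] := eqVneq (foldr (fun r z => f z - r *: z) y rs) 0.
  by move=> e _; apply: IH.
move=> /subr0_eq e; exists (foldr (fun r z => f z - r *: z) y rs); split=> //.
  by elim: {e nz IH} rs => //= r' rs; apply: Qf.
by exists r.
Qed.

(** A group element is a root of X^n - 1 for n its order, and this polynomial splits over k. *)
Lemma annihilated_gelt (a : gT) (y : kG) :
  exists rs, foldr (fun r z => gelt a * z - r *: z) y rs = 0.
Proof.
have [rs e] := closed_field_poly_normal ('X^#[a]%g - 1 : {poly k}).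
exists rs.
have -> : foldr (fun r z => gelt a * z - r *: z) y rs
   = horner_alg (gelt a) (\prod_(z <- rs) ('X - z%:P)) * y.
  elim: rs {e} => [|r rs IH] /=; first by rewrite big_nil rmorph1 mul1r.
  by rewrite big_cons rmorphM rmorphB /= horner_algX horner_algC IH mulrBl mulrBl !mulrA
    -!scalerAl mul1r.
have l1 : lead_coef ('X^#[a]%g - 1 : {poly k}) = 1.
  by apply/eqP; rewrite -monicE monicXnsubC ?order_gt0.
move: e; rewrite l1 scale1r => <-.
rewrite rmorphB rmorph1 rmorphXn /= horner_algX.
have -> : gelt a ^+ #[a]%g = gelt (a ^+ #[a])%g :> kG.
  by elim: #[a]%g => [|n IH]; rewrite ?expr0 // exprS IH -geltM expgS.
by rewrite expg_order gelt1 subrr mul0r.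
Qed.

Hypothesis abelA : abelian A.

(** If e = 1 - sum P_mu were nonzero, the elements killed by every P_mu would form a nonzero
    A-stable subspace. As A is abelian, this subspace contains a common eigenvector y of A; its
    eigenvalues form a character mu, so P_mu y = y, which contradicts P_mu y = 0. *)
Lemma sum_Pproj : \sum_(mu : dual) Pproj mu = 1.
Proof.
apply/eqP; rewrite eq_sym -subr_eq0; apply/negPn/negP => e0.
set e := _ - _ in e0.
pose Q (y : kG) := forall mu, Pproj mu * y = 0.
have Qe : Q e.
  move=> mu; rewrite mulrBr mulr1 mulr_sumr (bigD1 mu) //= Pproj_idem big1.
    by rewrite addr0 subrr.
  by move=> nu ne; rewrite Pproj_orth // eq_sym.
have QA a r y : a \in A -> Q y -> Q (gelt a * y - r *: y).
  move=> Aa Qy mu; rewrite mulrBr mulrA Pproj_gelt // -scalerAl -scalerAr.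
  by rewrite Qy !scaler0 subrr.
have [y [Qy y0 hy]] : exists y, [/\ Q y, y != 0 &
    forall a, a \in A -> exists r, gelt a * y = r *: y].
  have : {subset enum A <= A} by move=> a; rewrite mem_enum.
  suff H (s : seq gT) : {subset s <= A} -> exists y, [/\ Q y, y != 0 &
      forall a, a \in s -> exists r, gelt a * y = r *: y].
    by move=> /H[y [? ? h]]; exists y; split=> // a Aa; apply: h; rewrite mem_enum.
  elim: s => [|a s IH] sA; first by exists e.
  have Aa : a \in A by apply: sA; rewrite mem_head.
  have [y [Qy y0 hy]] := IH (fun b bs => sA b (mem_behead (s := a :: s) bs)).
  have [rs ers] := annihilated_gelt a y.
  (* Being an eigenvector of the elements already treated is preserved by [gelt a] - r because A is
     commutative. *)
  pose Q' y := Q y /\ forall b, b \in s -> exists r, gelt b * y = r *: y.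
  have [||||z [[Qz hz] z0 [r hr]]] :=
    @eigenvector_of_annihilator kG ( *%R (gelt a)) Q' rs y.
  - move=> r z [Qz hz]; split; first exact: QA.
    move=> b bs; have [r' e'] := hz b bs; exists r'.
    have Ab : b \in A by apply: sA; rewrite inE bs orbT.
    rewrite mulrBr mulrA -geltM (centsP abelA b Ab a Aa) geltM -mulrA e'.
    by rewrite -scalerAr -scalerAr e' scalerBr !scalerA [r * r']mulrC.
  - by [].
  - by [].
  - exact: ers.
  exists z; split=> // b; rewrite inE => /orP[/eqP->|]; last exact: hz.
  by exists r.
have /fin_all_exists[r hr] : forall a, exists r, a \in A -> gelt a * y = r *: y.
  move=> a; case: (boolP (a \in A)) => [/hy[r hr]|]; first by exists r.
  by exists 0.
pose f : {ffun gT -> k} := [ffun a => if a \in A then r a else 0].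
have inj c d : c *: y = d *: y -> c = d.
  by move/eqP; rewrite -subr_eq0 -scalerBl scaler_eq0 (negPf y0) orbF subr_eq0 => /eqP.
have fch : is_char A f.
  apply/and3P; split.
  - rewrite ffunE group1; apply/eqP/inj; rewrite -hr // gelt1 mul1r scale1r //.
  - apply/forall_inP => a Aa; apply/forall_inP => b Ab; apply/eqP.
    rewrite !ffunE Aa Ab groupM //; apply: inj.
    by rewrite -hr ?groupM // geltM -mulrA !hr // -scalerAr hr // scalerA mulrC.
  - by apply/forallP => a; apply/implyP => /negPf nA; rewrite ffunE nA.
have w : has_weight idfun (DualGroup fch) y.
  by move=> a Aa /=; rewrite hr // /char_val /= ffunE Aa.
by move: y0; rewrite -(Pproj_weight w) /= Qy eqxx.
Qed.

End WeightProjectors.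

(** * Induced modules *)

Section InductionFacts.
Variables (k : closedFieldType) (gT : finGroupType) (K : {group gT}).
Variables (n : nat) (rho : gT -> 'M[k]_n).

Lemma ind_ext (u v : ind K rho) : (forall g, ind_fun u g = ind_fun v g) -> u = v.
Proof. by move=> e; apply/val_inj/ffunP. Qed.

Lemma ind_funD (u v : ind K rho) g : ind_fun (u + v) g = ind_fun u g + ind_fun v g.
Proof. by rewrite -[ind_fun _]/(val (u + v)) raddfD ffunE. Qed.

Lemma ind_funZ a (u : ind K rho) g : ind_fun (a *: u) g = a *: ind_fun u g.
Proof. by rewrite -[ind_fun _]/(val (a *: u)) linearZ ffunE. Qed.

Lemma ind_fun_sum I (r : seq I) (P : pred I) (F : I -> ind K rho) g :
  ind_fun (\sum_(i <- r | P i) F i) g = \sum_(i <- r | P i) ind_fun (F i) g.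
Proof.
rewrite -[ind_fun _]/(val (\sum_(i <- r | P i) F i)) raddf_sum sum_ffunE.
by [].
Qed.

Lemma ind_funM (u : ind K rho) g h :
  h \in K -> ind_fun u (g * h)%g = rho h^-1%g *m ind_fun u g.
Proof. by case: u => u /= /ind_predP; apply. Qed.

Lemma ind_fun_act g (u : ind K rho) x :
  ind_fun (ind_act g u) x = ind_fun u (g^-1 * x)%g.
Proof. by rewrite /= ffunE. Qed.

Hypothesis rhoL : proj_linear K rho.

Lemma proj_linear1 : rho 1%g = 1%:M.
Proof.
have [_ /(_ _ (group1 K)) U _ /(_ _ _ (group1 K) (group1 K))] := rhoL.
by rewrite mulg1 scale1r => /(congr1 (mulmx (invmx (rho 1%g)))); rewrite mulKmx // mulVmx.
Qed.

Lemma proj_linearM : {in K &, forall g h, rho (g * h)%g = rho g *m rho h}.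
Proof. by move=> g h Kg Kh; have [_ _ _ ->] := rhoL; rewrite ?scale1r. Qed.

Lemma ind_fun_unit w g :
  ind_fun (ind_unit rhoL w) g = if g \in K then rho g^-1%g *m w else 0.
Proof. by rewrite /= ffunE. Qed.

Lemma ind_unit_act w h : h \in K ->
  ind_unit rhoL (rho h *m w) = ind_act h (ind_unit rhoL w).
Proof.
move=> Kh; apply: ind_ext => g; rewrite ind_fun_act !ind_fun_unit groupMl ?groupV //.
case: ifP => // Kg; rewrite mulmxA -proj_linearM ?groupV //.
by rewrite invMg invgK.
Qed.

Hypothesis char0 : [pchar k] =i pred0.

(** Summing over all of G instead of coset representatives counts each coset #|K| times with equal
    terms. *)
Lemma ind_decomp (v : ind K rho) :
  v = #|K|%:R^-1 *: \sum_g ind_act g (ind_unit rhoL (ind_fun v g)).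
Proof.
apply: ind_ext => x; rewrite ind_funZ ind_fun_sum.
rewrite (reindex_inj (mulgI x)).
rewrite (eq_bigr (fun h => if h \in K then ind_fun v x else 0)) => [|h _].
  rewrite -big_mkcond sumr_const /= -scaler_nat scalerA mulVf ?scale1r //.
  exact: natf_neq0_char0.
rewrite ind_fun_act ind_fun_unit invMg mulgKV groupV.
case: ifP => // Kh; rewrite ind_funM // mulmxA -proj_linearM ?groupV //.
by rewrite invgK mulgV proj_linear1 mul1mx.
Qed.

End InductionFacts.

Lemma char_mx_linear (k : closedFieldType) (gT : finGroupType) (A : {group gT})
  (s : dualgroup k A) : proj_linear A (char_mx s).
Proof.
split=> // [g Ag | g h _ _ | g h Ag Ah].
- by rewrite unitmxE det_scalar expr1 unitfE dual_char_neq0.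
- exact: oner_neq0.
- by rewrite scale1r /char_mx dual_charM // scalar_mxM.
Qed.

Section IndChar.
Variables (k : closedFieldType) (gT : finGroupType) (A : {group gT}).
Hypothesis char0 : [pchar k] =i pred0.
Variable s : dualgroup k A.
Local Notation kG := (galg k gT).
Local Notation indA := (ind A (char_mx s)).

(* Identifies Ind_A^G s with the left ideal k[G] P_s. *)
Definition ind_alg (f : indA) : kG :=
  [ffun g => #|A|%:R^-1 * ind_fun f g 0 0 : k^o].

Lemma coef_ind_alg f g : galg_coef (ind_alg f) g = #|A|%:R^-1 * ind_fun f g 0 0.
Proof. by rewrite /galg_coef ffunE. Qed.

Fact ind_alg_linear : linear ind_alg.
Proof.
move=> a u v; apply: galg_eqP => g.
rewrite galg_coefD galg_coefZ !coef_ind_alg ind_funD ind_funZ !mxE.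
by rewrite mulrDr mulrCA.
Qed.
HB.instance Definition _ := GRing.isLinear.Build k indA kG _ ind_alg ind_alg_linear.

Lemma ind_alg_act g f : ind_alg (ind_act g f) = gelt g * ind_alg f.
Proof.
by apply: galg_eqP => x; rewrite galg_coef_gelt_mul !coef_ind_alg ind_fun_act.
Qed.

Lemma ind_alg_unit : ind_alg (ind_unit (char_mx_linear s) 1%:M) = Pproj s.
Proof.
apply: galg_eqP => g; rewrite coef_ind_alg ind_fun_unit /Pproj galg_coefZ.
congr (_ * _); rewrite galg_coef_sum.
case: ifP => Ag.
  rewrite (bigD1 g) //= galg_coefZ galg_coef_gelt eqxx mulr1 big1 ?addr0.
    rewrite mulmx1 mxE eqxx mulr1n; apply: (mulIf (dual_char_neq0 s Ag)).
    by rewrite mulVf ?dual_char_neq0 // -dual_charM ?groupV // mulVg dual_char1.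
  by move=> h /andP[_ /negPf ne]; rewrite galg_coefZ galg_coef_gelt eq_sym ne mulr0.
rewrite mxE big1 // => h Ah; rewrite galg_coefZ galg_coef_gelt.
by case: eqP => [e|]; rewrite ?mulr0 // e Ah in Ag *.
Qed.

Lemma ind_alg_Pproj f : ind_alg f * Pproj s = ind_alg f.
Proof.
rewrite /Pproj -scalerAr mulr_sumr.
transitivity (#|A|%:R^-1 *: \sum_(a in A) ind_alg f).
  congr (_ *: _); apply: eq_bigr => a Aa; rewrite -scalerAr.
  apply: galg_eqP => g; rewrite galg_coefZ galg_coef_mul_gelt !coef_ind_alg mulrCA.
  rewrite ind_funM ?groupV // invgK mul_scalar_mx mxE.
  by rewrite mulKf // dual_char_neq0.
rewrite sumr_const -scaler_nat scalerA mulVf ?scale1r //.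
exact: natf_neq0_char0.
Qed.

(** Every f is obtained from the generator 1 (x) 1 by acting with the element [ind_alg f] of k[G],
    so a G-map out of Ind_A s is determined by its value on that generator. *)
Lemma ind_alg_decomp f :
  f = \sum_g galg_coef (ind_alg f) g *:
        ind_act g (ind_unit (char_mx_linear s) 1%:M).
Proof.
rewrite {1}(ind_decomp (char_mx_linear s) char0 f) scaler_sumr.
apply: eq_bigr => g _; apply: ind_ext => x.
rewrite coef_ind_alg -scalerA !ind_funZ; congr (_ *: _).
rewrite !ind_fun_act !ind_fun_unit; case: ifP => _; last by rewrite scaler0.
by rewrite [ind_fun f g]mx11_scalar scalemxAr scalemx1 mxE mulr1n.
Qed.

End IndChar.

(** * The exchange kernel of a dynamical datum *)

Section AlgebraMatrices.
Variables (k : fieldType) (B : algType k).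

Definition alg_mx m n (X : 'M[k]_(m, n)) : 'M[B]_(m, n) := map_mx (in_alg B) X.

Lemma alg_mxM m n p (X : 'M_(m, n)) (Y : 'M_(n, p)) :
  alg_mx (X *m Y) = alg_mx X *m alg_mx Y.
Proof. exact: map_mxM. Qed.

Lemma alg_mx1 n : alg_mx (1%:M : 'M_n) = 1%:M.
Proof. exact: map_mx1. Qed.

Lemma alg_mxE m n (X : 'M[k]_(m, n)) i j : alg_mx X i j = (X i j)%:A.
Proof. by rewrite mxE. Qed.

Lemma mul_mx_scalarE m n (X : 'M[B]_(m, n)) b i j : (X *m b%:M) i j = X i j * b.
Proof.
rewrite mxE (bigD1 j) //= !mxE eqxx mulr1n big1 ?addr0 // => l /negPf ne.
by rewrite mxE ne mulr0n mulr0.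
Qed.

Lemma mul_scalar_mxE m n (X : 'M[B]_(m, n)) b i j : (b%:M *m X) i j = b * X i j.
Proof. by rewrite mul_scalar_mx mxE. Qed.

Lemma comm_mx_scalarl m n (X : 'M[B]_(m, n)) b :
  (forall i j, GRing.comm (X i j) b) -> X *m b%:M = b%:M *m X.
Proof.
by move=> Xb; apply/matrixP => i j; rewrite mul_mx_scalarE mul_scalar_mxE Xb.
Qed.

Lemma alg_mx_scalar m n (X : 'M[k]_(m, n)) b : alg_mx X *m b%:M = b%:M *m alg_mx X.
Proof.
apply: comm_mx_scalarl => i j; rewrite alg_mxE /GRing.comm.
by rewrite -scalerAl -scalerAr mul1r mulr1.
Qed.

Lemma alg_mx_sandwich m n p q (X : 'M[k]_(m, n)) (M : 'M[B]_(n, p))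
    (Y : 'M[k]_(p, q)) i j :
  (alg_mx X *m M *m alg_mx Y) i j =
    \sum_b \sum_a (X i a * Y b j) *: M a b.
Proof.
rewrite mxE; apply: eq_bigr => b _; rewrite mxE mulr_suml; apply: eq_bigr => a _.
rewrite !alg_mxE -scalerAl mul1r -scalerAr mulr1 scalerA.
by rewrite mulrC.
Qed.

Lemma mxtrace_mul_scalar n (X : 'M[B]_n) b : \tr (X *m b%:M) = \tr X * b.
Proof.
by rewrite /mxtrace mulr_suml; apply: eq_bigr => i _; rewrite mul_mx_scalarE.
Qed.

Lemma mxtrace_mulE m n (X : 'M[B]_(m, n)) (Y : 'M[B]_(n, m)) :
  \tr (X *m Y) = \sum_i \sum_j X i j * Y j i.
Proof. by rewrite /mxtrace; apply: eq_bigr => i _; rewrite mxE. Qed.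

End AlgebraMatrices.

Arguments alg_mx {k B m n} X.

Lemma map_alg_mx (k : fieldType) (B B' : algType k) (phi : {lrmorphism B -> B'})
    m n (X : 'M[k]_(m, n)) : map_mx phi (alg_mx X : 'M[B]_(m, n)) = alg_mx X.
Proof. by apply/matrixP => i j; rewrite !mxE rmorph_alg. Qed.

Lemma cV_tens_basis (k : fieldType) m n (w : 'cV[k]_(m * n)) :
  w = \sum_q \sum_p w (mxtens_index (q, p)) 0 *: delta_mx (mxtens_index (q, p)) 0.
Proof.
apply/colP => r; case: (mxtens_indexP r) => q p; rewrite summxE.
rewrite (bigD1 q) //= summxE (bigD1 p) //= !mxE eqxx mulr1 big1 => [|p' ne].
  rewrite addr0 big1 ?addr0 // => q' ne; rewrite summxE big1 // => p' _.
  rewrite !mxE (can_eq (@mxtens_indexK _ _)) xpair_eqE eq_sym (negPf ne).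
  by rewrite mulr0.
rewrite !mxE (can_eq (@mxtens_indexK _ _)) xpair_eqE [p == _]eq_sym (negPf ne).
by rewrite andbF mulr0.
Qed.

Section Kernel.
Variables (k : closedFieldType) (gT : finGroupType) (A : {group gT}).
Local Notation kG := (galg k gT).
Local Notation dual := (dualgroup k A).
Variable D : dyn_datum k A.
Local Notation d := (dd_dim D).
Local Notation pi := (dd_rep D).

(** [Phi] stands for a map V_l -> V_kap (x) B; the condition is linearity over the central extension
    of K, with K acting on B by left multiplication through [phi]. *)
Definition equivariant (B : algType k) (phi : kG -> B) l kap
    (Phi : 'M[B]_(d kap, d l)) :=
  {in D, forall h, alg_mx (pi kap h) *m (phi (gelt h))%:M *m Phi
    = Phi *m alg_mx (pi l h)}.

(* T l kap is Psi(l, -) for the weight l - kap, seen in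
   Hom(V_l, V_kap) (x) k[G]; S l kap carries the inverse of eps. *)
Record exchange_kernel (T : forall l kap : dual, 'M[kG]_(d kap, d l))
    (S : forall l kap : dual, 'M[kG]_(d l, d kap)) : Prop := ExchangeKernel {
  xk_weight : forall l kap i j, T l kap i j * Pproj (l - kap) = T l kap i j;
  xk_equiv : forall l kap, equivariant idfun (T l kap);
  xk_inv_equiv : forall l kap, {in D, forall h,
    S l kap *m (gelt h)%:M *m alg_mx (pi kap h) = alg_mx (pi l h) *m S l kap};
  xk_trace : forall l kap, \tr (S l kap *m T l kap) = Pproj (l - kap);
  xk_section : forall l kap (B : algType k) (phi : {lrmorphism kG -> B})
      (Phi : 'M[B]_(d kap, d l)), equivariant phi Phi ->
    map_mx phi (T l kap) *m (\tr (map_mx phi (S l kap) *m Phi))%:M = Phi }.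

Lemma dd_unitmx l h : h \in D -> pi l h \in unitmx.
Proof. by have [c [_ U _ _]] := dd_proj D l; apply: U. Qed.

Lemma dd_dim_gt0 l : (0 < d l)%N.
Proof. by have [c []] := dd_proj D l. Qed.

(** The indices are swapped in [mxtens_index (j, i)] because V_l is the first tensor factor of the
    induced module, while j labels the columns, that is, the basis of V_l. *)
Definition exch_mx (eps : eps_family D) l kap : 'M[kG]_(d kap, d l) :=
  \matrix_(i, j) ind_alg (eps l kap (ind_unit (dd_hom_linear D l kap)
    (delta_mx (mxtens_index (j, i)) 0))).

Hypothesis char0 : [pchar k] =i pred0.
Variable eps : eps_family D.
Hypothesis eps_iso : forall l kap, ind_iso (eps l kap).

Section Pair.
Variables l kap : dual.
Local Notation rhoL := (dd_hom_linear D l kap).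
Local Notation T := (exch_mx eps l kap).

Fact ind_unit_linear : linear (ind_unit rhoL).
Proof.
move=> a u v; apply: ind_ext => g; rewrite ind_funD ind_funZ !ind_fun_unit.
by case: ifP; rewrite ?mulmxDr ?scalemxAr // scaler0 addr0.
Qed.
HB.instance Definition _ := GRing.isLinear.Build k _ _ _ (ind_unit rhoL) ind_unit_linear.

Lemma exch_mx_expand w :
  ind_alg (eps l kap (ind_unit rhoL w)) =
    \sum_q \sum_p w (mxtens_index (q, p)) 0 *: T p q.
Proof.
rewrite {1}(cV_tens_basis w) !linear_sum; apply: eq_bigr => q _ /=.
by rewrite !linear_sum; apply: eq_bigr => p _ /=; rewrite !linearZ /= mxE.
Qed.

Lemma exch_mx_equiv : equivariant idfun T.
Proof.
move=> h Kh; have Uh := dd_unitmx kap Kh.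
suff : (gelt h)%:M *m T = alg_mx (invmx (pi kap h)) *m T *m alg_mx (pi l h).
  by move=> e; rewrite -mulmxA /= e !mulmxA -alg_mxM (mulmxV Uh) alg_mx1 mul1mx.
apply/matrixP => i j; rewrite alg_mx_sandwich mul_scalar_mxE {1}mxE -ind_alg_act.
have [_ <-] := eps_iso l kap; rewrite -ind_unit_act // exch_mx_expand.
apply: eq_bigr => q _; apply: eq_bigr => p _; congr (_ *: _).
by rewrite -colE mxE tensmxE mulrC mxE.
Qed.

(** S lists the values of f0 = eps^-1(1 (x) 1). The trace identity is eps f0 = 1 (x) 1, with f0
    expanded by [ind_decomp]; the equivariance of S is the transformation rule f0(g h) = h^-1 f0(g).
    The product formula expresses that eps^-1 eps fixes 1 (x) w for basis vectors w of V_l tensored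
    with the dual of V_kap. *)
Lemma exch_mx_inverse : exists S : 'M[kG]_(d l, d kap),
  [/\ \tr (S *m T) = Pproj (l - kap),
      {in D, forall h,
        S *m (gelt h)%:M *m alg_mx (pi kap h) = alg_mx (pi l h) *m S}
    & forall i j q p, T i j * S q p = #|D|%:R^-1 *: \sum_(x in D)
        (pi l x^-1%g q j * invmx (pi kap x^-1%g) i p) *: gelt x].
Proof.
have [eb eG] := eps_iso l kap; have [e' eK e'K] := eb.
pose u1 := ind_unit (char_mx_linear (l - kap)) 1%:M.
pose f0 := e' u1.
pose S : 'M[kG]_(d l, d kap) := \matrix_(q, p)
  (#|D|%:R^-1 *: \sum_g ind_fun f0 g (mxtens_index (q, p)) 0 *: gelt g).
have coefS q p x : galg_coef (S q p) x =
    #|D|%:R^-1 * ind_fun f0 x (mxtens_index (q, p)) 0.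
  rewrite mxE galg_coefZ; congr (_ * _); rewrite galg_coef_sum (bigD1 x) //=.
  rewrite galg_coefZ galg_coef_gelt eqxx mulr1 big1 ?addr0 // => g /negPf ne.
  by rewrite galg_coefZ galg_coef_gelt eq_sym ne mulr0.
exists S; split.
- have <- : ind_alg (eps l kap f0) = Pproj (l - kap) by rewrite e'K ind_alg_unit.
  rewrite {1}(ind_decomp rhoL char0 f0) !linearZ !linear_sum /= mxtrace_mulE.
  under [X in _ *: X]eq_bigr => g _.
    rewrite eG ind_alg_act exch_mx_expand mulr_sumr; over.
  rewrite scaler_sumr /=.
  under [RHS]eq_bigr => g _ do rewrite scaler_sumr.
  rewrite [RHS]exchange_big /=; apply: eq_bigr => q _.
  under [RHS]eq_bigr => g _ do rewrite mulr_sumr scaler_sumr.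
  rewrite [RHS]exchange_big /=; apply: eq_bigr => p _.
  rewrite {1}/S mxE -scalerAl mulr_suml scaler_sumr; apply: eq_bigr => g _.
  by rewrite -scalerAl -scalerAr.
- move=> h Kh; have Uh := dd_unitmx kap Kh.
  suff -> : S *m (gelt h)%:M = alg_mx (pi l h) *m S *m alg_mx (invmx (pi kap h)).
    by rewrite -!mulmxA -alg_mxM (mulVmx Uh) alg_mx1 mulmx1.
  apply/matrixP => q p; rewrite alg_mx_sandwich mul_mx_scalarE.
  apply: galg_eqP => x; rewrite galg_coef_mul_gelt coefS.
  rewrite ind_funM ?groupV // invgK galg_coef_sum.
  under [RHS]eq_bigr => b _ do rewrite galg_coef_sum.
  rewrite [ind_fun f0 x]cV_tens_basis mulmx_sumr summxE mulr_sumr.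
  rewrite [RHS]exchange_big /=; apply: eq_bigr => a _.
  rewrite mulmx_sumr summxE mulr_sumr; apply: eq_bigr => b _.
  rewrite galg_coefZ coefS -scalemxAr mxE -colE mxE tensmxE [(_^T) _ _]mxE.
  by rewrite mulrA mulrC.
move=> i j q p; apply: galg_eqP => x; rewrite galg_coefM galg_coefZ.
under eq_bigr => g _ do rewrite coefS mulrCA.
rewrite -mulr_sumr; congr (_ * _).
pose w : 'cV[k]_(d l * d kap) := delta_mx (mxtens_index (j, i)) 0.
(* In Ind_A one has eps(1 (x) w) = T_ij (1 (x) 1); pulled back by eps this reads 1 (x) w = T_ij f0.
   The left side is supported on K, with value x^-1 w at x. *)
have : ind_unit rhoL w = \sum_g galg_coef (T i j) g *: ind_act g f0.
  apply: (can_inj eK); rewrite linear_sum /=.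
  rewrite (ind_alg_decomp char0 (eps l kap (ind_unit rhoL w))).
  apply: eq_bigr => g _; rewrite linearZ /= eG e'K; congr (_ *: _).
  by rewrite mxE.
move/(congr1 (fun v => ind_fun v x (mxtens_index (q, p)) 0)).
rewrite ind_fun_sum summxE => e.
transitivity (\sum_g ind_fun (galg_coef (T i j) g *: ind_act g f0) x
   (mxtens_index (q, p)) 0).
  by apply: eq_bigr => g _; rewrite ind_funZ [RHS]mxE ind_fun_act.
rewrite -e ind_fun_unit galg_coef_sum; case: ifP => Kx.
  rewrite (bigD1 x) //= galg_coefZ galg_coef_gelt eqxx mulr1 big1 ?addr0.
    by rewrite -colE mxE tensmxE [(_^T) _ _]mxE.
  by move=> g /andP[_ /negPf ne]; rewrite galg_coefZ galg_coef_gelt eq_sym ne mulr0.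
rewrite mxE big1 // => g Kg; rewrite galg_coefZ galg_coef_gelt.
by case: eqP => [eg|]; rewrite ?mulr0 // eg Kg in Kx *.
Qed.

End Pair.

(** For [xk_section], the product formula turns T_ij tr(S Phi) into the average over x in K, with y
    = x^-1, of the (i, j) entry of pi_kap(y)^-1 phi(x) Phi pi_l(y). Each such matrix equals Phi when
    Phi is equivariant. *)
Lemma exch_mx_kernel : exists S, exchange_kernel (exch_mx eps) S.
Proof.
pose Q l kap (S : 'M[kG]_(d l, d kap)) :=
  [/\ \tr (S *m exch_mx eps l kap) = Pproj (l - kap),
      {in D, forall h,
        S *m (gelt h)%:M *m alg_mx (pi kap h) = alg_mx (pi l h) *m S}
    & forall i j q p, exch_mx eps l kap i j * S q p = #|D|%:R^-1 *: \sum_(x in D)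
        (pi l x^-1%g q j * invmx (pi kap x^-1%g) i p) *: gelt x].
(* Finite choice over the dual group, one index at a time because the type of S depends on both. *)
have /fin_all_exists[S hS] : forall l, exists S, forall kap, Q l kap (S kap).
  by move=> l; apply: (fin_all_exists (P := Q l)) => kap; apply: exch_mx_inverse.
exists S; split=> [l kap i j|l kap|l kap h|l kap|l kap B phi Phi Phi_eq].
- by rewrite mxE ind_alg_Pproj.
- exact: exch_mx_equiv.
- by have [_ hE _] := hS l kap; exact: (hE h).
- by have [] := hS l kap.
have [_ _ hTS] := hS l kap.
apply/matrixP => i j; rewrite mul_mx_scalarE [map_mx _ _ _ _]mxE mxtrace_mulE.
transitivity (#|D|%:R^-1 *: \sum_(x in D) Phi i j); last first.
  by rewrite sumr_const -scaler_nat scalerA mulVf ?scale1r // natf_neq0_char0.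
rewrite mulr_sumr.
under eq_bigr => q _.
  rewrite mulr_sumr; under eq_bigr => p _.
    rewrite [map_mx phi (S l kap) q p]mxE mulrA -rmorphM /= hTS linearZ.
    rewrite linear_sum /= -scalerAl mulr_suml; over.
  rewrite -scaler_sumr exchange_big /=; over.
rewrite -scaler_sumr exchange_big /=; congr (_ *: _); apply: eq_bigr => x Dx.
have Dy : x^-1%g \in D by rewrite groupV.
have := Phi_eq _ Dy; set y := x^-1%g => ey.
transitivity ((alg_mx (invmx (pi kap y)) *m ((phi (gelt x))%:M *m Phi)
  *m alg_mx (pi l y)) i j).
  rewrite alg_mx_sandwich; apply: eq_bigr => q _; apply: eq_bigr => p _.
  by rewrite linearZ /= -scalerAl mul_scalar_mxE mulrC.
rewrite -!mulmxA -ey !mulmxA alg_mx_scalar -[_ *m alg_mx (pi kap y)]mulmxA.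
rewrite -alg_mxM (mulVmx (dd_unitmx kap Dy)) alg_mx1 mulmx1 -scalar_mxM -rmorphM /=.
by rewrite geltV rmorph1 mul1mx.
Qed.

End Kernel.

(** * The twist of an exchange kernel *)

(** In finite dimension, left multiplication by v is injective, hence bijective; this gives v a
    right inverse, which must coincide with u. *)
Lemma falg_left_inverse_unit (F : fieldType) (B : falgType F) (u v : B) :
  u * v = 1 -> v \is a GRing.unit.
Proof.
move=> uv1; pose w : B := ((amull v)^-1)%VF 1.
have vw1 : v * w = 1.
  have /lker0_compfV e : lker (amull v) == 0%VS.
    apply/lker0P => x y; rewrite !lfunE /= => /(congr1 ( *%R u)).
    by rewrite !mulrA uv1 !mul1r.
  by move/lfunP/(_ 1): e; rewrite comp_lfunE id_lfunE lfunE.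
have uw : u = w by rewrite -[u]mulr1 -vw1 mulrA uv1 mul1r.
by apply/unitrP; exists u; split=> //; rewrite uw.
Qed.

Lemma galg_tens2E (k : closedFieldType) (gT : finGroupType)
    (u : galg k (gT * gT)%type) (v : galg k gT) :
  galg_tens u v = tens2_one u * one_tens2 (one_tens1 v).
Proof.
rewrite /tens2_one /one_tens2 /one_tens1 galg_map_comp.
rewrite [in RHS](galgE u) [in RHS](galgE v) !linear_sum mulr_suml /galg_tens.
apply: eq_bigr => -[g g'] _; rewrite mulr_sumr; apply: eq_bigr => h _.
rewrite !linearZ /= !galg_map_gelt -scalerAl -scalerAr scalerA -geltM.
by congr (_ *: gelt (pair (pair _ _) _)); rewrite ?mulg1 ?mul1g.
Qed.

Lemma dual_charD (k : closedFieldType) (gT : finGroupType) (A : {group gT})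
  (mu nu : dualgroup k A) a : (mu + nu) a = mu a * nu a.
Proof. by rewrite {1}/char_val /= ffunE. Qed.

Lemma tens1_mulM (k : closedFieldType) (gT : finGroupType) (u v u' v' : galg k gT) :
  (tens1_one u * one_tens1 v) * (tens1_one u' * one_tens1 v')
    = tens1_one (u * u') * one_tens1 (v * v').
Proof.
rewrite !rmorphM /= !mulrA -[_ * one_tens1 v * _]mulrA -tens1_one_comm.
by rewrite !mulrA.
Qed.

Section TensorWeights.
Variables (k : closedFieldType) (gT : finGroupType) (A : {group gT}).
Local Notation kG := (galg k gT).
Local Notation kGG := (galg k (gT * gT)%type).
Local Notation dual := (dualgroup k A).
Hypothesis char0 : [pchar k] =i pred0.
Hypothesis abelA : abelian A.

(** The order follows the composite V_l -> V_kap (x) X -> V_tau (x) Y (x) X: nu = kap - tau is the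
    weight in the left factor Y, and mu = l - kap the weight in X. *)
Definition Pproj2 (nu mu : dual) : kGG :=
  tens1_one (Pproj nu) * one_tens1 (Pproj mu).

Lemma sum_Pproj2 : \sum_mu \sum_nu Pproj2 nu mu = 1.
Proof.
rewrite /Pproj2; under eq_bigr => mu _ do
  rewrite -mulr_suml -raddf_sum /= (sum_Pproj char0 abelA) rmorph1 mul1r.
by rewrite -raddf_sum /= (sum_Pproj char0 abelA) rmorph1.
Qed.

Lemma eq_on_Pproj2 (u v : kGG) :
  (forall nu mu, u * Pproj2 nu mu = v * Pproj2 nu mu) -> u = v.
Proof.
move=> e; rewrite -[u]mulr1 -[v]mulr1 -sum_Pproj2 !mulr_sumr.
by apply: eq_bigr => mu _; rewrite !mulr_sumr; apply: eq_bigr.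
Qed.

Lemma Pproj2_mul nu mu nu' mu' :
  Pproj2 nu mu * Pproj2 nu' mu' = Pproj2 nu mu *+ ((nu == nu') && (mu == mu')).
Proof.
rewrite /Pproj2 tens1_mulM !Pproj_mul //.
by case: eqP => _; case: eqP => _; rewrite ?raddf0 ?mulr0 ?mul0r.
Qed.

Lemma comul_Pproj2 nu mu : has_weight (@comul k gT) (mu + nu) (Pproj2 nu mu).
Proof.
move=> a Aa; rewrite comul_gelt /Pproj2 tens1_mulM !gelt_Pproj // !linearZ /=.
by rewrite -scalerAl -scalerAr scalerA dual_charD mulrC.
Qed.

Lemma zero_weight2P (u : kGG) :
  (forall nu mu, has_weight (@comul k gT) (mu + nu) (u * Pproj2 nu mu)) ->
  {in A, forall a, comul (gelt a) * u = u * comul (gelt a)}.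
Proof.
move=> hu a Aa; apply: eq_on_Pproj2 => nu mu.
by rewrite -!mulrA hu // comul_Pproj2 // scalerAr.
Qed.

End TensorWeights.

(** * Uniqueness, existence and Schur's lemma for exchange kernels; units and counits *)

Section KernelTheory.
Variables (k : closedFieldType) (gT : finGroupType) (A : {group gT}).
Local Notation kG := (galg k gT).
Local Notation kGG := (galg k (gT * gT)%type).
Local Notation dual := (dualgroup k A).
Local Notation i1 := (@tens1_one k gT).
Local Notation i2 := (@one_tens1 k gT).
Local Notation Delta := (@comul k gT).
Local Notation cu := (@counit_unit k gT).
Hypothesis char0 : [pchar k] =i pred0.
Variable D : dyn_datum k A.
Local Notation d := (dd_dim D).
Local Notation pi := (dd_rep D).
Variables (T : forall l kap : dual, 'M[kG]_(d kap, d l))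
          (S : forall l kap : dual, 'M[kG]_(d l, d kap)).
Hypothesis xkTS : exchange_kernel T S.

Lemma kernel_equivariant (B : algType k) (phi : {lrmorphism kG -> B}) l kap :
  equivariant phi (map_mx phi (T l kap)).
Proof.
move=> h Kh; have /(congr1 (map_mx phi)) := xk_equiv xkTS l kap Kh.
by rewrite !map_mxM !map_alg_mx map_scalar_mx.
Qed.

(** Taking the trace against S turns T x into P_(l - kap) x, which is x for x of that weight. *)
Lemma kernel_inj (B : algType k) (phi : {lrmorphism kG -> B}) l kap x y :
    has_weight phi (l - kap) x -> has_weight phi (l - kap) y ->
  map_mx phi (T l kap) *m x%:M = map_mx phi (T l kap) *m y%:M -> x = y.
Proof.
move=> hx hy /(congr1 (fun M => \tr (map_mx phi (S l kap) *m M))).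
rewrite !mulmxA !mxtrace_mul_scalar -map_mxM.
have -> : \tr (map_mx phi (S l kap *m T l kap)) = phi (Pproj (l - kap)).
  by rewrite -(xk_trace xkTS) /mxtrace raddf_sum; apply: eq_bigr => i _; rewrite mxE.
by rewrite !(Pproj_weight char0).
Qed.

Lemma kernel_inj1 l kap (x y : kG) :
    has_weight idfun (l - kap) x -> has_weight idfun (l - kap) y ->
  T l kap *m x%:M = T l kap *m y%:M -> x = y.
Proof.
move=> hx hy; have := @kernel_inj _ idfun l kap x y hx hy.
by rewrite (map_mx_id (f := idfun) (fun=> erefl)).
Qed.

Lemma kernel_weight l kap (B : algType k) (phi : {lrmorphism kG -> B}) :
  map_mx phi (T l kap) *m (phi (Pproj (l - kap)))%:M = map_mx phi (T l kap).
Proof.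
apply/matrixP => i j; rewrite mul_mx_scalarE mxE -rmorphM /=.
by rewrite (xk_weight xkTS).
Qed.

Lemma kernel_weight_neq l kap (B : algType k) (phi : {lrmorphism kG -> B}) s x :
    has_weight phi s x -> l - kap != s -> map_mx phi (T l kap) *m x%:M = 0.
Proof.
move=> hx ne; rewrite -kernel_weight -mulmxA -scalar_mxM.
rewrite (has_weight_disjoint (phi := phi) (mu := l - kap) (nu := s) 0 0) //.
  by rewrite raddf0 mulmx0.
by move=> a Aa; rewrite -rmorphM /= Pproj_gelt // linearZ.
Qed.

(** The coefficient tr(S Phi) is multiplied by P_(l - kap) to acquire the right weight; T absorbs
    that projector. *)
Lemma kernel_surj (B : algType k) (phi : {lrmorphism kG -> B}) l kap
    (Phi : 'M[B]_(d kap, d l)) : equivariant phi Phi ->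
  exists2 x, has_weight phi (l - kap) x & map_mx phi (T l kap) *m x%:M = Phi.
Proof.
move=> hPhi; exists (phi (Pproj (l - kap)) * \tr (map_mx phi (S l kap) *m Phi)).
  by move=> a Aa; rewrite mulrA -rmorphM /= gelt_Pproj // linearZ /= scalerAl.
by rewrite scalar_mxM mulmxA kernel_weight (xk_section xkTS).
Qed.

Lemma kernel_prod_equivariant l kap tau :
  equivariant Delta
    (map_mx i1 (T kap tau) *m map_mx i2 (T l kap)).
Proof.
move=> h Kh; have := kernel_equivariant i2 l kap Kh.
have := kernel_equivariant i1  kap tau Kh.
have : map_mx i1 (T kap tau) *m (one_tens1 (gelt h))%:M
    = (one_tens1 (gelt h))%:M *m map_mx i1 (T kap tau).
  by apply: comm_mx_scalarl => i j; rewrite mxE; apply: tens1_one_comm.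
rewrite comul_gelt scalar_mxM.
move: (map_mx _ _) (map_mx _ _) => Y X cX eX eY.
rewrite -!mulmxA (mulmxA _ X Y) -cX -!mulmxA !(mulmxA (alg_mx _)) (mulmxA _ X) eX.
by rewrite -!mulmxA (mulmxA (alg_mx _)) eY.
Qed.

(** The factor h of k[G] stands to the right of S in one equivariance and to the left of T in the
    other, so it disappears from the product, and only the action on V_l and V_kap remains. *)
Lemma kernel_intertwine l kap tau h : h \in D ->
  alg_mx (pi kap h) *m (S kap tau *m T l tau)
    = S kap tau *m T l tau *m alg_mx (pi l h).
Proof.
move=> Kh; have := xk_inv_equiv xkTS kap tau Kh; have := xk_equiv xkTS l tau Kh.
rewrite /=; move: (S kap tau) (T l tau) => X Y eY eX.
rewrite mulmxA -eX -[RHS]mulmxA -eY !mulmxA -[_ *m _ *m alg_mx _]mulmxA.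
by rewrite -alg_mx_scalar mulmxA.
Qed.

Hypothesis normT : forall l, map_mx cu (T l l) = 1%:M.

Lemma counit_unit_gelt h : counit_unit (gelt h : kG) = 1.
Proof. by rewrite /counit_unit galg_map_gelt. Qed.

Lemma kernel_schur l kap (X : 'M[kG]_(d kap, d l)) :
    {in D, forall h, alg_mx (pi kap h) *m X = X *m alg_mx (pi l h)} ->
  exists x, X = map_mx cu (T l kap) *m x%:M.
Proof.
move=> hX; have [|x _ <-] := kernel_surj (phi := cu) (Phi := X); last by exists x.
by move=> h Kh; rewrite /= counit_unit_gelt mulmx1 hX.
Qed.

(** The intertwiner S T factors through the counit of T(l, kap), and hence through the counit of
    P_(l - kap), which is 0 for kap different from l. *)
Lemma kernel_orth l kap tau : kap != l -> S kap tau *m T l tau = 0.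
Proof.
move=> ne; have [|x ->] := kernel_schur (X := S kap tau *m T l tau).
  by move=> h Kh; apply: kernel_intertwine.
rewrite -kernel_weight /= (counit_unit_Pproj char0) subr_eq0 eq_sym (negPf ne).
by rewrite raddf0 mulmx0 mul0mx.
Qed.

(** By Schur and the normalization S T is a scalar matrix x, so its trace P_(kap - tau) is d_kap
    x. *)
Lemma kernel_diag kap tau :
  (S kap tau *m T kap tau) *+ d kap = (Pproj (kap - tau))%:M.
Proof.
have [|x e] := kernel_schur (X := S kap tau *m T kap tau).
  by move=> h Kh; apply: kernel_intertwine.
move: e; rewrite normT mul1mx => e.
by rewrite -(xk_trace xkTS) e mxtrace_scalar -raddfMn.
Qed.

Section Twist.
Hypothesis abelA : abelian A.
Local Notation P2 := (@Pproj2 k gT A).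

(** The composition law defining J, written once in k[G] (x) k[G]: [i1] carries the module Y and
    [i2] the module X. The idempotent stands for the restriction to vectors y, x of weights kap -
    tau and l - kap. *)
Definition exchange_relation (J : dual -> kGG) := forall l kap tau,
  map_mx i1 (T kap tau) *m map_mx i2 (T l kap)
    = map_mx Delta (T l tau) *m (J l * P2 (kap - tau) (l - kap))%:M.

Definition exchange_weight (J : dual -> kGG) := forall l nu mu,
  has_weight Delta (mu + nu) (J l * P2 nu mu).

(** Each pair (kap, tau) gives its own solution x, valid on P_(kap - tau) (x) P_(l - kap). For fixed
    l these idempotents are orthogonal and distinct pairs give distinct ones, so the solutions glue
    to one [J l]; multiplying by the idempotent leaves the composite of the two T unchanged. *)
Lemma exchange_relation_ex :
  exists J, exchange_relation J /\ exchange_weight J.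
Proof.
pose Q l kap tau (x : kGG) := has_weight Delta (l - tau) x /\
  map_mx i1 (T kap tau) *m map_mx i2 (T l kap)
    = map_mx Delta (T l tau) *m x%:M.
have /fin_all_exists[x hx] : forall p : dual * dual * dual, exists x,
    Q p.1.1 p.1.2 p.2 x.
  move=> [[l kap] tau]; have [x ? e] := kernel_surj (kernel_prod_equivariant l kap tau).
  by exists x; split.
pose J l := \sum_(p : dual * dual) x (l, p.1, p.2) * P2 (p.1 - p.2) (l - p.1).
have JP l kap tau : J l * P2 (kap - tau) (l - kap)
    = x (l, kap, tau) * P2 (kap - tau) (l - kap).
  have single p : x (l, p.1, p.2) * P2 (p.1 - p.2) (l - p.1) * P2 (kap - tau) (l - kap)
      = if p == (kap, tau) then x (l, kap, tau) * P2 (kap - tau) (l - kap) else 0.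
    case: eqP => [-> /=|/eqP ne]; rewrite -mulrA Pproj2_mul ?eqxx //.
    have -> : (p.1 - p.2 == kap - tau) && (l - p.1 == l - kap) = false.
      apply: contraNF ne => /andP[+ /eqP/(can_inj (subKr l)) e]; rewrite e.
      by move=> /eqP/(can_inj (subKr kap)) e2; rewrite [p]surjective_pairing e e2.
    exact: mulr0.
  rewrite /J mulr_suml (eq_bigr _ (fun p _ => single p)).
  by rewrite -big_mkcond /= big_pred1_eq.
have w l nu mu : has_weight Delta (mu + nu) (J l * P2 nu mu).
  have := JP l (l - mu) (l - mu - nu); rewrite !subKr => ->.
  move=> a Aa; have [hw _] := hx (l, l - mu, l - mu - nu).
  by rewrite mulrA hw //= -addrA -opprD subKr scalerAl.
exists J; split=> // l kap tau; rewrite JP scalar_mxM mulmxA.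
have [_ /= <-] := hx (l, kap, tau).
apply/matrixP => i j; rewrite mul_mx_scalarE mxE mulr_suml; apply: eq_bigr => b _.
by rewrite !mxE /Pproj2 tens1_mulM !(xk_weight xkTS).
Qed.

Variable J : dual -> kGG.
Hypothesis relJ : exchange_relation J.
Hypothesis wtJ : exchange_weight J.

Lemma twist_comm l : {in A, forall a, comul (gelt a) * J l = J l * comul (gelt a)}.
Proof. by apply: zero_weight2P => // nu mu; apply: wtJ. Qed.

Lemma twist_zero_weight l : zero_weight2 A (J l).
Proof. by move=> a Aa; have := twist_comm l Aa; rewrite /comul galg_map_gelt. Qed.

Lemma eq_on_Pproj (u v : kG) : (forall mu : dual, u * Pproj mu = v * Pproj mu) -> u = v.
Proof.
move=> e; rewrite -[u]mulr1 -[v]mulr1 -(sum_Pproj char0 abelA) !mulr_sumr.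
exact: eq_bigr.
Qed.

(** With tau = kap the first factor T(kap, kap) becomes the identity under the counit, and both
    [counit_id (J l)] P_mu and P_mu solve T(l, l - mu) z = T(l, l - mu). *)
Lemma twist_counit_id l : counit_id (J l) = 1.
Proof.
apply: eq_on_Pproj => mu; rewrite mul1r.
have w : has_weight idfun mu (counit_id (J l) * Pproj mu).
  move=> a Aa /=; have /(congr1 (@counit_id k gT)) := twist_comm l Aa.
  rewrite !rmorphM /= counit_id_comul mulrA => ->.
  by rewrite -mulrA gelt_Pproj // scalerAr.
have := relJ l (l - mu) (l - mu); rewrite subrr subKr.
move=> /(congr1 (map_mx (@counit_id k gT))); rewrite !map_mxM -!map_mx_comp map_scalar_mx.
rewrite (eq_map_mx _ (@counit_id_tens1 k gT)) normT mul1mx.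
rewrite (eq_map_mx _ (@counit_id_one_tens1 k gT)).
rewrite (eq_map_mx _ (@counit_id_comul k gT)) /=.
have -> : counit_id (J l * P2 0 mu) = counit_id (J l) * Pproj mu.
  rewrite !rmorphM /= counit_id_tens1 counit_id_one_tens1.
  by rewrite (counit_unit_Pproj char0) eqxx mul1r.
move=> e.
apply/esym/(kernel_inj1 (l := l) (kap := l - mu)).
- by rewrite subKr; apply: gelt_Pproj.
- by rewrite subKr.
rewrite !(map_mx_id (f := id) (fun=> erefl)) in e; rewrite -e.
apply/matrixP => i j; rewrite mul_mx_scalarE.
by have := xk_weight xkTS i j; rewrite subKr.
Qed.

(** The mirror case: kap = l makes the second factor T(l, l) trivial. *)
Lemma twist_id_counit l : id_counit (J l) = 1.
Proof.
apply: eq_on_Pproj => nu; rewrite mul1r.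
have w : has_weight idfun nu (id_counit (J l) * Pproj nu).
  move=> a Aa /=; have /(congr1 (@id_counit k gT)) := twist_comm l Aa.
  rewrite !rmorphM /= id_counit_comul mulrA => ->.
  by rewrite -mulrA gelt_Pproj // scalerAr.
have := relJ l l (l - nu); rewrite subrr subKr.
move=> /(congr1 (map_mx (@id_counit k gT))); rewrite !map_mxM -!map_mx_comp map_scalar_mx.
rewrite (eq_map_mx _ (@id_counit_one_tens1 k gT)) normT mulmx1.
rewrite (eq_map_mx _ (@id_counit_tens1 k gT)) (eq_map_mx _ (@id_counit_comul k gT)) /=.
have -> : id_counit (J l * P2 nu 0) = id_counit (J l) * Pproj nu.
  rewrite !rmorphM /= id_counit_tens1 id_counit_one_tens1.
  by rewrite (counit_unit_Pproj char0) eqxx mulr1.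
move=> e.
apply/esym/(kernel_inj1 (l := l) (kap := l - nu)).
- by rewrite subKr; apply: gelt_Pproj.
- by rewrite subKr.
rewrite !(map_mx_id (f := id) (fun=> erefl)) in e; rewrite -e.
apply/matrixP => i j; rewrite mul_mx_scalarE.
by have := xk_weight xkTS i j; rewrite subKr.
Qed.

(** The exchange relation freed of its idempotents. For given mu = l - kap, only nu = kap - tau
    contributes, since T(l, tau) kills all weights other than l - tau. *)
Lemma twist_sum l tau :
  map_mx Delta (T l tau) *m (J l)%:M =
    \sum_kap map_mx i1 (T kap tau) *m map_mx i2 (T l kap).
Proof.
have single kap nu : map_mx Delta (T l tau) *m (J l * P2 nu (l - kap))%:M =
    if nu == kap - tau then map_mx i1 (T kap tau) *m map_mx i2 (T l kap) else 0.
  case: eqP => [->|/eqP ne]; first exact/esym/relJ.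
  apply: (kernel_weight_neq (@wtJ l nu (l - kap))).
  by rewrite -{1}(subrK kap l) -addrA (inj_eq (addrI _)) eq_sym.
have column kap : map_mx Delta (T l tau) *m (J l * \sum_nu P2 nu (l - kap))%:M =
    map_mx i1 (T kap tau) *m map_mx i2 (T l kap).
  rewrite mulr_sumr raddf_sum mulmx_sumr (eq_bigr _ (fun nu _ => single kap nu)).
  by rewrite -big_mkcond /= big_pred1_eq.
rewrite -[J l]mulr1 -(sum_Pproj2 char0 abelA) mulr_sumr raddf_sum mulmx_sumr.
rewrite (reindex_inj (inj_comp (addrI l) oppr_inj)).
exact: (eq_bigr _ (fun kap _ => column kap)).
Qed.

(* The inverse is the exchange of the opposite intertwiners S: by Schur's
   lemma d_kap S_{kap,tau} T_{kap',tau} is P_{kap - tau} for kap' = kap and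
   vanishes otherwise, which makes it a left inverse. *)
Lemma twist_unit l : J l \is a GRing.unit.
Proof.
pose J' := \sum_tau \sum_kap
  \tr (map_mx i2 (S l kap) *m map_mx i1 (S kap tau) *m map_mx Delta (T l tau)) *+ d kap.
apply: (falg_left_inverse_unit (u := J')).
have term kap tau :
    (\tr (map_mx i2 (S l kap) *m map_mx i1 (S kap tau) *m map_mx Delta (T l tau))
       *+ d kap) * J l = P2 (kap - tau) (l - kap).
  rewrite mulrnAl -mxtrace_mul_scalar -(mulmxA _ (map_mx Delta (T l tau))).
  rewrite (twist_sum l tau) mulmx_sumr raddf_sum.
  rewrite (bigD1 kap) //= big1 => [|kap' ne]; last first.
    rewrite -!mulmxA (mulmxA (map_mx i1 _)) -map_mxM kernel_orth 1?eq_sym //.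
    by rewrite raddf0 mul0mx mulmx0 raddf0.
  (* The multiplicity d_kap is carried inside the trace onto the inner product S T, where
     [kernel_diag] needs it. *)
  rewrite addr0 -!mulmxA (mulmxA (map_mx i1 _)) -map_mxM -raddfMn -(raddfMn (mulmx _)).
  rewrite /= -(raddfMn (mulmxr _)) /= -raddfMn kernel_diag /= map_scalar_mx.
  (* The projector P_(kap - tau) lives on the first leg and commutes with matrices on the second,
     which leaves tr(S T) = P_(l - kap) there. *)
  rewrite -comm_mx_scalarl; last first.
    by move=> i j; rewrite mxE; apply/commr_sym/tens1_one_comm.
  rewrite mulmxA mxtrace_mul_scalar -map_mxM.
  by rewrite trace_map_mx (xk_trace xkTS) /= -tens1_one_comm.
rewrite /J' mulr_suml -[RHS](sum_Pproj2 char0 abelA).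
under eq_bigr => tau _.
  rewrite mulr_suml; under eq_bigr => kap _ do rewrite term; over.
rewrite exchange_big /= [RHS](reindex_inj (inj_comp (addrI l) oppr_inj)) /=.
apply: eq_bigr => kap _.
by rewrite [RHS](reindex_inj (inj_comp (addrI kap) oppr_inj)).
Qed.

Lemma comul_Pproj_twist l nu mu s : s = mu + nu ->
  comul (Pproj s) * (J l * P2 nu mu) = J l * P2 nu mu.
Proof. by move=> ->; apply: (Pproj_weight char0 (phi := Delta)); apply: wtJ. Qed.

End Twist.
End KernelTheory.

(** * The twist equation from the two bracketings of a triple composite *)

Section TwistEquation.
Variables (k : closedFieldType) (gT : finGroupType) (A : {group gT}).
Local Notation kG := (galg k gT).
Local Notation kGG := (galg k (gT * gT)%type).
Local Notation dual := (dualgroup k A).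
Local Notation i1 := (@tens1_one k gT).
Local Notation i2 := (@one_tens1 k gT).
Local Notation Delta := (@comul k gT).
Local Notation P2 := (@Pproj2 k gT A).
Local Notation t12 := (@tens2_one k gT).
Local Notation t23 := (@one_tens2 k gT).
Local Notation c12 := (@comul_id k gT).
Local Notation c23 := (@id_comul k gT).

Hypothesis char0 : [pchar k] =i pred0.
Hypothesis abelA : abelian A.
Variable D : dyn_datum k A.
Local Notation d := (dd_dim D).
Variables (T : forall l kap : dual, 'M[kG]_(d kap, d l))
          (S : forall l kap : dual, 'M[kG]_(d l, d kap)).
Hypothesis xkTS : exchange_kernel T S.
Variable J : dual -> kGG.
Hypothesis relJ : exchange_relation T J.
Hypothesis wtJ : exchange_weight J.

Lemma tens2_mulM u v u' v' :
  (t12 u * t23 (i2 v)) * (t12 u' * t23 (i2 v')) = t12 (u * u') * t23 (i2 (v * v')).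
Proof.
rewrite !rmorphM /= -!mulrA; congr (_ * _).
by rewrite mulrA -tens2_one_comm -!mulrA.
Qed.

Lemma tens2_mulM' u v u' v' :
  (t12 (i1 u) * t23 v) * (t12 (i1 u') * t23 v') = t12 (i1 (u * u')) * t23 (v * v').
Proof.
rewrite !rmorphM /= -!mulrA; congr (_ * _).
by rewrite mulrA one_tens2_comm -!mulrA.
Qed.

Lemma comul_id_comul_gelt g :
  c12 (Delta (gelt g)) = t12 (Delta (gelt g)) * t23 (i2 (gelt g)).
Proof.
by rewrite [in LHS]comul_gelt rmorphM /= comul_id_tens1 comul_id_one_tens1.
Qed.

Lemma id_comul_comul_gelt g :
  c23 (Delta (gelt g)) = t12 (i1 (gelt g)) * t23 (Delta (gelt g)).
Proof.
by rewrite [in LHS]comul_gelt rmorphM /= id_comul_tens1 id_comul_one_tens1.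
Qed.

(** The two T's on the left are exchanged before the third. They start at V_kap with kap = l - mu,
    and this is the origin of the shifted argument in J(l - mu) (x) P_mu. *)
Lemma comul_id_twist l kap th tau :
  map_mx (t12 \o i1) (T th tau) *m map_mx (t12 \o i2) (T kap th)
      *m map_mx (t23 \o i2) (T l kap)
  = map_mx (c12 \o Delta) (T l tau) *m
    (c12 (J l) *
      (t12 (J kap * P2 (th - tau) (kap - th)) * t23 (i2 (Pproj (l - kap)))))%:M.
Proof.
have -> : map_mx (t12 \o i1) (T th tau) *m map_mx (t12 \o i2) (T kap th)
    = map_mx (c12 \o i1) (T kap tau) *m (t12 (J kap * P2 (th - tau) (kap - th)))%:M.
  rewrite (map_mx_comp i1 t12) (map_mx_comp i2 t12)
    -map_mxM relJ map_mxM map_scalar_mx -map_mx_comp.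
  by congr (_ *m _); apply: eq_map_mx => u; rewrite /= comul_id_tens1.
rewrite -mulmxA -comm_mx_scalarl; last first.
  by move=> i j; rewrite mxE; apply/commr_sym/tens2_one_comm.
have -> : map_mx (t23 \o i2) (T l kap) = map_mx (c12 \o i2) (T l kap).
  by apply: eq_map_mx => u; rewrite /= comul_id_one_tens1.
rewrite mulmxA (map_mx_comp i1 c12) (map_mx_comp i2 c12) (map_mx_comp Delta c12).
rewrite -map_mxM relJ map_mxM map_scalar_mx -mulmxA.
rewrite -scalar_mxM; congr (_ *m _%:M); rewrite /= rmorphM -mulrA; congr (_ * _).
(* The second exchange brings in P_(kap - tau) on its first leg, which [c12] comultiplies. It is
   absorbed by J(kap) P2, whose weight is (kap - th) + (th - tau). *)
rewrite rmorphM /= comul_id_tens1 comul_id_one_tens1 -mulrA -tens2_one_comm mulrA.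
by rewrite -rmorphM /= comul_Pproj_twist // addrA subrK.
Qed.

(** The other bracketing: both exchanges start at V_l, so J appears without shift. Coassociativity
    brings the result over the same matrix as in [comul_id_twist]. *)
Lemma id_comul_twist l kap th tau :
  map_mx (t12 \o i1) (T th tau) *m map_mx (t12 \o i2) (T kap th)
      *m map_mx (t23 \o i2) (T l kap)
  = map_mx (c12 \o Delta) (T l tau) *m
    (c23 (J l) * (t12 (i1 (Pproj (th - tau))) * t23 (J l * P2 (kap - th) (l - kap))))%:M.
Proof.
have -> : map_mx (t12 \o i2) (T kap th) = map_mx (t23 \o i1) (T kap th).
  by apply: eq_map_mx => u; rewrite /= tens2_one_one_tens1.
rewrite -mulmxA (map_mx_comp i1 t23) (map_mx_comp i2 t23)
    -map_mxM relJ map_mxM map_scalar_mx -map_mx_comp.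
have -> : map_mx (t23 \o Delta) (T l th) = map_mx (c23 \o i2) (T l th).
  by apply: eq_map_mx => u; rewrite /= id_comul_one_tens1.
have -> : map_mx (t12 \o i1) (T th tau) = map_mx (c23 \o i1) (T th tau).
  by apply: eq_map_mx => u; rewrite /= id_comul_tens1.
have -> : map_mx (c12 \o Delta) (T l tau) = map_mx (c23 \o Delta) (T l tau).
  by apply: eq_map_mx => u; rewrite /= comulA.
rewrite mulmxA (map_mx_comp i1 c23) (map_mx_comp i2 c23) (map_mx_comp Delta c23).
rewrite -map_mxM relJ map_mxM map_scalar_mx -mulmxA.
rewrite -scalar_mxM; congr (_ *m _%:M); rewrite /= rmorphM -mulrA; congr (_ * _).
rewrite rmorphM /= id_comul_tens1 id_comul_one_tens1 -mulrA; congr (_ * _).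
by rewrite -rmorphM /= comul_Pproj_twist // addrA subrK.
Qed.

(** On each P_rho (x) P_nu (x) P_mu the two sides are the coefficients of the same triple composite,
    whose intermediate modules are forced: kap = l - mu, th = kap - nu, tau = th - rho. Uniqueness
    of coefficients along (Delta (x) id) Delta then gives equality. *)
Lemma twist_equation l :
  comul_id (J l) * \sum_mu galg_tens (J (l - mu)) (Pproj mu)
    = id_comul (J l) * one_tens2 (J l).
Proof.
set L := _ * _; set R := _ * _.
suff e (rho nu mu : dual) : L * (t12 (P2 rho nu) * t23 (i2 (Pproj mu)))
    = R * (t12 (P2 rho nu) * t23 (i2 (Pproj mu))).
  have one : \sum_(mu : dual) \sum_(nu : dual) \sum_(rho : dual)
      t12 (P2 rho nu) * t23 (i2 (Pproj mu)) = 1.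
    have row (mu nu : dual) : \sum_rho t12 (P2 rho nu) * t23 (i2 (Pproj mu)) =
        t12 (\sum_rho P2 rho nu) * t23 (i2 (Pproj mu)).
      by rewrite -mulr_suml -raddf_sum.
    rewrite (eq_bigr (fun mu : dual => t23 (i2 (Pproj mu)))) => [|mu _].
      by rewrite -raddf_sum -raddf_sum /= (sum_Pproj char0 abelA) !rmorph1.
    rewrite (eq_bigr _ (fun nu _ => row mu nu)) -mulr_suml -raddf_sum /=.
    by rewrite (sum_Pproj2 char0 abelA) rmorph1 mul1r.
  rewrite -[L]mulr1 -[R]mulr1 -one !mulr_sumr; apply: eq_bigr => mu _.
  rewrite !mulr_sumr; apply: eq_bigr => nu _.
  by rewrite !mulr_sumr; apply: eq_bigr => rho _.
pose kap := l - mu; pose th := kap - nu; pose tau := th - rho.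
have [emu enu erho] : [/\ l - kap = mu, kap - th = nu & th - tau = rho].
  by rewrite !subKr.
have eL : L * (t12 (P2 rho nu) * t23 (i2 (Pproj mu))) =
    c12 (J l) * (t12 (J kap * P2 rho nu) * t23 (i2 (Pproj mu))).
  rewrite /L -mulrA; congr (_ * _); rewrite mulr_suml (bigD1 mu) //= big1 ?addr0.
    by rewrite galg_tens2E tens2_mulM Pproj_idem.
  by move=> mu' ne; rewrite galg_tens2E tens2_mulM Pproj_orth // !raddf0 mulr0.
have eR : R * (t12 (P2 rho nu) * t23 (i2 (Pproj mu))) =
    c23 (J l) * (t12 (i1 (Pproj rho)) * t23 (J l * P2 nu mu)).
  rewrite /R -mulrA; congr (_ * _); rewrite rmorphM /= tens2_one_one_tens1.
  by rewrite -mulrA -rmorphM mulrA one_tens2_comm -mulrA -rmorphM.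
rewrite eL eR.
have wl : mu + nu + rho = l - tau by rewrite /tau /th /kap -!addrA -!opprD subKr.
have := comul_id_twist l kap th tau; rewrite (id_comul_twist l kap th tau).
rewrite emu enu erho => /esym.
(* What remains is that both coefficients have weight mu + nu + rho = l - tau: J commutes with the
   diagonal A, which moves the group element onto the idempotents. *)
apply: (kernel_inj char0 xkTS (phi := c12 \o Delta ) (l := l) (kap := tau)).
- move=> a Aa /=; rewrite mulrA -rmorphM /= (twist_comm char0 abelA wtJ) // rmorphM /= -mulrA.
  rewrite comul_id_comul_gelt tens2_mulM wtJ // gelt_Pproj // !linearZ /=.
  rewrite -scalerAl -!scalerAr scalerA -wl !dual_charD.
  by congr (_ *: _); rewrite mulrC mulrA.
- move=> a Aa /=; rewrite comulA mulrA -rmorphM /= (twist_comm char0 abelA wtJ) // rmorphM /= -mulrA.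
  rewrite id_comul_comul_gelt tens2_mulM' wtJ // gelt_Pproj // !linearZ /=.
  rewrite -scalerAl -!scalerAr scalerA -wl !dual_charD.
  by congr (_ *: _); rewrite mulrC.
Qed.

End TwistEquation.

(** * Exchange operators on modules *)

Section GroupAlgebraAction.
Variables (k : fieldType) (H : finGroupType) (n : nat) (r : H -> 'M[k]_n).

Fact galg_act_linear : linear (galg_act r).
Proof.
move=> a u v; rewrite /galg_act scaler_sumr -big_split /=.
by apply: eq_bigr => h _; rewrite galg_coefD galg_coefZ scalerDl scalerA.
Qed.
HB.instance Definition _ :=
  GRing.isLinear.Build k (galg k H) 'M[k]_n _ (galg_act r) galg_act_linear.

Lemma galg_act_gelt h : galg_act r (gelt h) = r h.
Proof.
rewrite /galg_act (bigD1 h) //= galg_coef_gelt eqxx scale1r.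
by rewrite big1 ?addr0 // => i /negPf ni; rewrite galg_coef_gelt ni scale0r.
Qed.

Lemma galg_actM : {morph r : g h / (g * h)%g >-> g *m h} ->
  {morph galg_act r : u v / u * v >-> u *m v}.
Proof.
move=> rM u v.
have gM g w : galg_act r (gelt g * w) = r g *m galg_act r w.
  rewrite (galgE w) mulr_sumr !linear_sum; apply: eq_bigr => h _ /=.
  by rewrite -scalerAr !linearZ /= -geltM !galg_act_gelt rM -galgE.
rewrite {1}(galgE u) mulr_suml linear_sum [galg_act r u]/galg_act mulmx_suml.
by apply: eq_bigr => g _; rewrite /= -scalerAl linearZ /= gM -scalemxAl.
Qed.

End GroupAlgebraAction.

Lemma galg_act_map (k : fieldType) (H1 H2 : finGroupType) n (f : H1 -> H2)
    (r : H2 -> 'M[k]_n) u : galg_act r (galg_map f u) = galg_act (r \o f) u.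
Proof.
apply: (galg_lin_eq (f := galg_act r \o galg_map f)) => h /=.
by rewrite galg_map_gelt !galg_act_gelt.
Qed.

Section TensorAction.
Variables (k : closedFieldType) (gT : finGroupType) (m n : nat).
Variables (rY : mx_representation k [set: gT] m) (rX : mx_representation k [set: gT] n).

Definition tens_act (p : gT * gT) : 'M[k]_(m * n) := rY p.1 *t rX p.2.

Lemma galg_act_reprM : {morph galg_act rX : u v / u * v >-> u *m v}.
Proof. by apply: galg_actM => g h; rewrite repr_mxM ?inE. Qed.

Lemma tens_actM : {morph galg_act tens_act : u v / u * v >-> u *m v}.
Proof.
by apply: galg_actM => g h; rewrite /tens_act /= !repr_mxM ?inE // tensmx_mul.
Qed.

Lemma tens_act_comul u : galg_act tens_act (comul u) = galg_act (tens_repr rY rX) u.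
Proof. by rewrite /comul galg_act_map. Qed.

Lemma tens_act_tens u v :
  galg_act tens_act (tens1_one u * one_tens1 v) = galg_act rY u *t galg_act rX v.
Proof.
rewrite tens_actM /tens1_one /one_tens1 !galg_act_map.
transitivity ((galg_act rY u *t 1%:M) *m (1%:M *t galg_act rX v)); last first.
  by rewrite tensmx_mul mulmx1 mul1mx.
congr (_ *m _).
  apply/matrixP => i j; case: (mxtens_indexP i) => i0 i1; case: (mxtens_indexP j) => j0 j1.
  rewrite tensmxE !summxE mulr_suml; apply: eq_bigr => h _.
  by rewrite mxE /= /tens_act tensmxE repr_mx1 [(_ *: rY h) _ _]mxE mulrA.
apply/matrixP => i j; case: (mxtens_indexP i) => i0 i1; case: (mxtens_indexP j) => j0 j1.
rewrite tensmxE !summxE mulr_sumr; apply: eq_bigr => h _.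
by rewrite mxE /= /tens_act tensmxE repr_mx1 [(_ *: rX h) _ _]mxE mulrCA.
Qed.

End TensorAction.

Section RegularRepresentation.
Variables (k : closedFieldType) (gT : finGroupType).

Definition reg_mx (g : gT) : 'M[k]_#|gT| :=
  \matrix_(i, j) (enum_val i == (g * enum_val j)%g)%:R.

Fact reg_mx_repr : mx_repr [set: gT] reg_mx.
Proof.
split=> [|g h _ _]; apply/matrixP => i j; rewrite !mxE.
  by rewrite mul1g (inj_eq enum_val_inj).
rewrite (bigD1 (enum_rank (h * enum_val j)%g)) //= !mxE enum_rankK eqxx mulr1 mulgA.
rewrite big1 ?addr0 // => a ne; rewrite !mxE [enum_val a == _](can2_eq enum_valK enum_rankK).
by rewrite (negPf ne) mulr0.
Qed.
Definition reg_repr := MxRepresentation reg_mx_repr.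

Definition reg_one : 'cV[k]_#|gT| := delta_mx (enum_rank 1%g) 0.

(** Acting on 1 (x) 1 in the tensor square of the regular module displays the coefficients of an
    element; this turns identities on modules into identities in k[G] (x) k[G]. *)
Lemma reg_act_faithful u v :
    galg_act (tens_act reg_repr reg_repr) u *m (reg_one *t reg_one)
      = galg_act (tens_act reg_repr reg_repr) v *m (reg_one *t reg_one) ->
  u = v.
Proof.
suff coefE w g : (galg_act (tens_act reg_repr reg_repr) w *m (reg_one *t reg_one))
    (mxtens_index (enum_rank g.1, enum_rank g.2)) 0 = galg_coef w g.
  by move=> e; apply: galg_eqP => g; rewrite -!coefE e.
have regE h i a : (reg_mx h *m reg_one) i a = (enum_val i == h)%:R.
  by rewrite (ord1 a) -colE !mxE enum_rankK mulg1.
have termE h : (tens_act reg_repr reg_repr h *m (reg_one *t reg_one))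
    (mxtens_index (enum_rank g.1, enum_rank g.2)) 0 = (h == g)%:R.
  rewrite /tens_act tensmx_mul /tensmx mxE !mxtens_indexK !regE !enum_rankK.
  by rewrite -natrM mulnb -xpair_eqE -!surjective_pairing eq_sym.
rewrite /galg_act mulmx_suml summxE (bigD1 g) //= -scalemxAl mxE termE eqxx mulr1.
rewrite big1 ?addr0 // => h /negPf ne.
by rewrite -scalemxAl mxE termE ne mulr0.
Qed.

End RegularRepresentation.

Lemma delta_tens (k : pzRingType) m n (i : 'I_m) (j : 'I_n) :
  (delta_mx i 0 : 'cV[k]_m) *t (delta_mx j 0 : 'cV_n)
    = delta_mx (mxtens_index (i, j)) 0 :> 'cV[k]_(m * n).
Proof.
apply/matrixP => r a; case: (mxtens_indexP r) => i' j'.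
rewrite /tensmx mxE !mxtens_indexK !mxE !(ord1 (_ : 'I_1)) !eqxx !andbT.
by rewrite -natrM mulnb (can_eq (@mxtens_indexK _ _)) xpair_eqE.
Qed.

Lemma tens_delta_mulE (k : pzRingType) m n q (i i' : 'I_m) (p : 'I_n) (j j' : 'I_q)
    (c : 'cV[k]_n) :
  ((((delta_mx i' 0 : 'cV[k]_m) *t c) : 'cV[k]_(m * n)) *m (delta_mx 0 j' : 'rV_q))
    (mxtens_index (i, p)) j = (i == i')%:R * c p 0 * (j == j')%:R.
Proof.
rewrite mxE big_ord1 /tensmx mxE !mxtens_indexK !mxE !(ord1 (_ : 'I_1)) !eqxx andbT.
by [].
Qed.

(** * Equivalence of the operator form and the algebra form of the exchange law *)

Section ExchangeRelation.
Variables (k : closedFieldType) (gT : finGroupType) (A : {group gT}).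
Local Notation kG := (galg k gT).
Local Notation kGG := (galg k (gT * gT)%type).
Local Notation dual := (dualgroup k A).
Local Notation i1 := (@tens1_one k gT).
Local Notation i2 := (@one_tens1 k gT).
Local Notation Delta := (@comul k gT).
Local Notation P2 := (@Pproj2 k gT A).
Hypothesis char0 : [pchar k] =i pred0.
Variable D : dyn_datum k A.
Local Notation d := (dd_dim D).
Variable eps : eps_family D.
Local Notation T := (exch_mx eps).

(** The averaging factor of Frobenius reciprocity is the one built into [ind_alg], so X enters only
    through the action of an element of k[G] that is the same for all X. *)
Lemma Psi_curriedE n (rX : mx_representation k [set: gT] n) l kap x w :
  @Psi_curried _ _ _ D eps n rX l kap x w =
    galg_act rX (ind_alg (eps l kap (ind_unit (dd_hom_linear D l kap) w))) *m x.
Proof.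
rewrite /Psi_curried /frob_ext /galg_act mulmx_suml scaler_sumr.
apply: eq_bigr => g _; rewrite coef_ind_alg -scalemxAl -scalemxAr scalerA.
by [].
Qed.

Lemma PsiE n (rX : mx_representation k [set: gT] n) l kap x i p j :
  Psi eps rX l kap x (mxtens_index (i, p)) j = (galg_act rX (T l kap i j) *m x) p 0.
Proof.
rewrite /Psi summxE (bigD1 i) //= summxE (bigD1 j) //= tens_delta_mulE !eqxx.
rewrite mul1r mulr1 Psi_curriedE delta_tens [exch_mx _ _ _ _ _]mxE.
rewrite big1 => [|j' ne]; last first.
  by rewrite tens_delta_mulE [j == _]eq_sym (negPf ne) mulr0.
rewrite addr0 big1 => [|i' ne]; first by rewrite addr0.
rewrite summxE big1 // => j' _.
by rewrite tens_delta_mulE eq_sym (negPf ne) !mul0r.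
Qed.

Lemma sum_mxtens (V : nmodType) m n (F : 'I_(m * n) -> V) :
  \sum_r F r = \sum_i \sum_j F (mxtens_index (i, j)).
Proof.
rewrite pair_big /= (reindex (@mxtens_index m n)) /=; last first.
  by apply: onW_bij; exists (@mxtens_unindex m n);
     [apply: mxtens_indexK | apply: mxtens_unindexK].
by apply: eq_bigr => -[].
Qed.

Section TwoModules.
Variables (m n : nat) (rY : mx_representation k [set: gT] m)
  (rX : mx_representation k [set: gT] n).
Variables (y : 'cV[k]_m) (x : 'cV[k]_n).
Local Notation act2 := (galg_act (tens_act rY rX)).
Local Notation yx := (y *t x : 'cV[k]_(m * n)).

Lemma tens_mul_cV (U : 'M[k]_m) (V : 'M[k]_n) :
  (U *t V) *m yx = ((U *m y) *t (V *m x) : 'cV[k]_(m * n)).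
Proof. exact: (tensmx_mul U V y x). Qed.

Lemma Psi_compE l kap tau i p q j :
  castmx (esym (mulnA _ _ _), erefl)
    ((Psi eps rY kap tau y *t (1%:M : 'M[k]_n)) *m Psi eps rX l kap x)
    (mxtens_index (i, mxtens_index (p, q))) j =
  (act2 ((map_mx i1 (T kap tau) *m map_mx i2 (T l kap)) i j) *m yx)
    (mxtens_index (p, q)) 0.
Proof.
rewrite castmxE /= cast_ord_id.
(* On indices the associator sends (i, (p, q)) to ((i, p), q); as numbers they agree. *)
have -> : cast_ord (esym (esym (mulnA (d tau) m n)))
    (mxtens_index (i, mxtens_index (p, q))) = mxtens_index (mxtens_index (i, p), q).
  by apply: val_inj; rewrite /= mulnDl addnA mulnA.
rewrite mxE [(map_mx i1 _ *m _) i j]mxE sum_mxtens raddf_sum mulmx_suml summxE; apply: eq_bigr => b _ /=.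
rewrite (bigD1 q) //= big1 => [|q' ne].
  rewrite addr0 tensmxE [1%:M q q]mxE eqxx mulr1 !PsiE ![map_mx _ _ _ _]mxE.
  rewrite tens_act_tens tens_mul_cV.
  by rewrite /tensmx [RHS]mxE !mxtens_indexK !(ord1 (_ : 'I_1)).
by rewrite tensmxE [1%:M q q']mxE eq_sym (negPf ne) mulr0 mul0r.
Qed.

Lemma Psi_composite_eq l kap tau (u : kGG) :
  castmx (esym (mulnA _ _ _), erefl)
    ((Psi eps rY kap tau y *t (1%:M : 'M[k]_n)) *m Psi eps rX l kap x)
    = Psi eps (tens_repr rY rX) l tau (act2 u *m yx) <->
  forall i j, act2 ((map_mx i1 (T kap tau) *m map_mx i2 (T l kap)) i j) *m yx
    = act2 ((map_mx Delta (T l tau) *m u%:M) i j) *m yx.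
Proof.
have rhsE i p q j : Psi eps (tens_repr rY rX) l tau (act2 u *m yx)
   (mxtens_index (i, mxtens_index (p, q))) j =
   (act2 ((map_mx Delta (T l tau) *m u%:M) i j) *m yx) (mxtens_index (p, q)) 0.
  by rewrite PsiE -tens_act_comul mulmxA -tens_actM mul_mx_scalarE [map_mx _ _ _ _]mxE.
split=> [e i j|e].
  apply/colP => r; case: (mxtens_indexP r) => p q.
  by rewrite -Psi_compE e rhsE.
apply/matrixP => r j; case: (mxtens_indexP r) => i r'; case: (mxtens_indexP r') => p q.
by rewrite Psi_compE rhsE e.
Qed.

End TwoModules.

Lemma weight_space_Pproj n (rX : mx_representation k [set: gT] n) (mu : dual) x :
  weight_space rX mu x -> galg_act rX (Pproj mu) *m x = x.
Proof.
move=> wx; rewrite linearZ linear_sum /= -scalemxAl mulmx_suml.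
rewrite (eq_bigr (fun=> x)) => [|a Aa].
  by rewrite sumr_const -scaler_nat scalerA mulVf ?scale1r // natf_neq0_char0.
rewrite linearZ /= galg_act_gelt -scalemxAl wx // scalerA mulVf ?scale1r //.
exact: dual_char_neq0.
Qed.

Lemma exchange_relation_is_exchange J :
  exchange_relation (exch_mx eps) J -> exchange_weight J -> is_exchange eps J.
Proof.
move=> rel wt m n rY rX l mu nu y x wx wy.
have eP : galg_act (tens_act rY rX) (P2 nu mu) *m (y *t x : 'cV[k]_(m * n)) = y *t x.
  by rewrite tens_act_tens tens_mul_cV !weight_space_Pproj.
split.
  move=> a Aa; rewrite -[X in _ *m X = _]/(galg_act (tens_act rY rX) (J l) *m _).
  rewrite -(galg_act_gelt (tens_repr rY rX)) -tens_act_comul.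
  rewrite -[in LHS]eP 2!mulmxA -!tens_actM -mulrA wt // linearZ /= -scalemxAl.
  by rewrite tens_actM -mulmxA eP.
apply/Psi_composite_eq => i j.
have := rel l (l - mu) (l - mu - nu); rewrite !subKr => ->.
rewrite scalar_mxM mulmxA mul_mx_scalarE tens_actM -mulmxA.
by rewrite eP.
Qed.

Section FromExchange.
Variable J : dual -> kGG.
Hypothesis hJ : is_exchange eps J.
Local Notation reg := (reg_repr k gT).
Local Notation one := (reg_one k gT).

(** The weight components of 1 in the regular module serve as universal weight vectors. *)
Let wv (mu : dual) : 'cV[k]_#|gT| := galg_act reg (Pproj mu) *m one.

Let weight_wv mu : weight_space reg mu (wv mu).
Proof.
move=> a Aa; rewrite -(galg_act_gelt reg) mulmxA -galg_act_reprM gelt_Pproj //.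
by rewrite linearZ /= -scalemxAl.
Qed.

Let wvE nu mu : (wv nu *t wv mu : 'cV[k]_(#|gT| * #|gT|))
  = galg_act (tens_act reg reg) (P2 nu mu) *m (one *t one).
Proof. by rewrite tens_act_tens tens_mul_cV. Qed.

Lemma is_exchange_weight : exchange_weight J.
Proof.
move=> l nu mu a Aa; apply: reg_act_faithful.
have [+ _] := hJ l (weight_wv mu) (weight_wv nu) => /(_ a Aa).
rewrite -[X in _ *m X = _]/(galg_act (tens_act reg reg) (J l) *m _).
rewrite -(galg_act_gelt (tens_repr reg reg)) -tens_act_comul wvE.
rewrite [galg_act _ (J l) *m (_ *m _)]mulmxA -tens_actM mulmxA -tens_actM => ->.
by rewrite linearZ /= -scalemxAl.
Qed.

Lemma is_exchange_relation : exchange_relation (exch_mx eps) J.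
Proof.
move=> l kap tau; apply/matrixP => i j.
have [_] := hJ l (weight_wv (l - kap)) (weight_wv (kap - tau)).
rewrite !subKr => /Psi_composite_eq/(_ i j).
rewrite wvE !mulmxA -!tens_actM => /reg_act_faithful e.
rewrite mul_mx_scalarE in e; rewrite mul_mx_scalarE mulrA -e.
rewrite mxE mulr_suml; apply: eq_bigr => b _.
rewrite ![map_mx _ _ _ _]mxE /Pproj2 tens1_mulM.
by rewrite [exch_mx _ _ _ i b]mxE [exch_mx _ _ _ b j]mxE !ind_alg_Pproj.
Qed.

End FromExchange.
End ExchangeRelation.

(** * Isomorphic data and gauge transformations *)

Lemma alg_mxZ (k : fieldType) (B : algType k) m n (a : k) (X : 'M[k]_(m, n)) :
  alg_mx (a *: X) = (a%:A : B)%:M *m alg_mx X.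
Proof.
apply/matrixP => i j; rewrite mul_scalar_mxE !alg_mxE mxE.
by rewrite -scalerAl mul1r scalerA.
Qed.

Section Sandwich.
Variables (k : fieldType) (B : algType k).

(** Removes the multiplier of a projective isomorphism: the same a occurs on both sides because the
    multiplier is common to all V_l. *)
Lemma alg_mx_equivariantZ m n (a : k) (X : 'M[k]_m) (Y : 'M[k]_n) (M : 'M[B]_(m, n)) b :
    a != 0 -> alg_mx (a *: X) *m b%:M *m M = M *m alg_mx (a *: Y) ->
  alg_mx X *m b%:M *m M = M *m alg_mx Y.
Proof.
move=> a0; have ca : M *m (a%:A)%:M = (a%:A)%:M *m M.
  apply: comm_mx_scalarl => i j; rewrite /GRing.comm.
  by rewrite -scalerAl -scalerAr mul1r mulr1.
rewrite !alg_mxZ (mulmxA M) ca -!mulmxA => /(congr1 (mulmx (a^-1%:A)%:M)).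
rewrite !(mulmxA (a^-1%:A)%:M) -scalar_mxM -scalerAl mul1r scalerA mulVf //.
by rewrite scale1r !mul1mx.
Qed.

Lemma sandwich_equivariant m n m' n' (b b' c : B)
    (phi : 'M[k]_(n', n)) (psi : 'M[k]_(n, n'))
    (phi' : 'M[k]_(m', m)) (psi' : 'M[k]_(m, m'))
    (X : 'M[k]_m') (Y : 'M[k]_n') (M : 'M[B]_(m', n')) :
    phi *m psi = 1%:M -> phi' *m psi' = 1%:M -> b * c = c * b' ->
    alg_mx X *m b'%:M *m M = M *m alg_mx Y ->
  alg_mx (psi' *m X *m phi') *m b%:M *m (c%:M *m (alg_mx psi' *m M *m alg_mx phi))
  = c%:M *m (alg_mx psi' *m M *m alg_mx phi) *m alg_mx (psi *m Y *m phi).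
Proof.
move=> phiK phiK' bc e.
have -> : c%:M *m (alg_mx psi' *m M *m alg_mx phi) *m alg_mx (psi *m Y *m phi)
    = c%:M *m (alg_mx psi' *m (M *m alg_mx Y) *m alg_mx phi).
  rewrite !alg_mxM -!mulmxA; do 3!congr (_ *m _).
  by rewrite (mulmxA (alg_mx phi)) -alg_mxM phiK alg_mx1 mul1mx.
rewrite -e -!mulmxA (mulmxA b%:M) -scalar_mxM bc (mulmxA (alg_mx _)) alg_mx_scalar.
rewrite scalar_mxM -!mulmxA; congr (_ *m _).
rewrite (mulmxA (alg_mx _) (alg_mx psi')) -alg_mxM -!mulmxA phiK' mulmx1 alg_mxM.
rewrite [in RHS](mulmxA (alg_mx X)) alg_mx_scalar -[in RHS]mulmxA.
by rewrite [in RHS](mulmxA (alg_mx psi')) alg_mx_scalar -!mulmxA.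
Qed.

Lemma sandwich_scalar m n m' n' (c x : B) (phi : 'M[k]_(n', n)) (psi : 'M[k]_(m, m'))
    (M : 'M[B]_(m', n')) :
  c%:M *m (alg_mx psi *m M *m alg_mx phi) *m x%:M
  = c%:M *m (alg_mx psi *m (M *m x%:M) *m alg_mx phi).
Proof. by rewrite -!mulmxA alg_mx_scalar. Qed.

Lemma sandwich_mul m n p m' n' p' (b c : B)
    (chi : 'M[k]_(p', p)) (phi : 'M[k]_(n', n)) (psi : 'M[k]_(n, n'))
    (psi' : 'M[k]_(m, m')) (M : 'M[B]_(m', n')) (N : 'M[B]_(n', p')) :
    phi *m psi = 1%:M -> (forall i j, GRing.comm (M i j) c) ->
  (b%:M *m (alg_mx psi' *m M *m alg_mx phi)) *m
    (c%:M *m (alg_mx psi *m N *m alg_mx chi))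
  = (b * c)%:M *m (alg_mx psi' *m (M *m N) *m alg_mx chi).
Proof.
move=> phiK Mc; rewrite scalar_mxM -!mulmxA; congr (_ *m _).
rewrite (mulmxA (alg_mx phi) c%:M) alg_mx_scalar -!mulmxA.
rewrite (mulmxA (alg_mx phi) (alg_mx psi)) -alg_mxM phiK alg_mx1 mul1mx.
rewrite (mulmxA M c%:M) (comm_mx_scalarl Mc) -!mulmxA.
by rewrite (mulmxA c%:M (alg_mx psi')) -alg_mx_scalar -!mulmxA.
Qed.

End Sandwich.

Section Transport.
Variables (k : closedFieldType) (gT : finGroupType) (A : {group gT}).
Local Notation kG := (galg k gT).
Local Notation dual := (dualgroup k A).

(** Isomorphism with explicit inverses [psi]. Choosing a before l encodes the common multiplier, and
    the symmetric form makes the inverse isomorphism available. *)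
Definition datum_iso (D D' : dyn_datum k A) (g : gT)
    (phi : forall l, 'M[k]_(dd_dim D' l, dd_dim D l))
    (psi : forall l, 'M[k]_(dd_dim D l, dd_dim D' l)) : Prop :=
  [/\ forall l, phi l *m psi l = 1%:M,
      forall l, psi l *m phi l = 1%:M,
      forall h, ((g * h * g^-1)%g \in D') = (h \in D)
    & {in D, forall h, exists2 a, a != 0 & forall l,
        a *: dd_rep D l h = psi l *m dd_rep D' l (g * h * g^-1)%g *m phi l}].

Lemma datum_iso_sym (D D' : dyn_datum k A) g phi psi :
  datum_iso (D := D) (D' := D') g phi psi -> datum_iso (D := D') (D' := D) g^-1%g psi phi.
Proof.
move=> [phiK psiK gD hpi]; split=> // [h|h Dh].
  by rewrite -gD invgK !mulgA mulgV mul1g mulgK.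
have Dh' : (g^-1 * h * g)%g \in D by rewrite -gD !mulgA mulgV mul1g mulgK.
have [a a0 ea] := hpi _ Dh'; exists a^-1; first by rewrite invr_eq0.
move=> l; apply: (scalerI a0); rewrite scalerA mulfV // scale1r invgK.
rewrite scalemxAl scalemxAr ea !mulmxA phiK mul1mx -mulmxA phiK mulmx1.
by rewrite !mulgA mulgV mul1g mulgK.
Qed.

Hypothesis char0 : [pchar k] =i pred0.
Variables D D' : dyn_datum k A.
Variables (g : gT) (phi : forall l, 'M[k]_(dd_dim D' l, dd_dim D l))
  (psi : forall l, 'M[k]_(dd_dim D l, dd_dim D' l)).
Hypothesis isoDD' : datum_iso g phi psi.
Variables (T : forall l kap : dual, 'M[kG]_(dd_dim D kap, dd_dim D l))
          (S : forall l kap : dual, 'M[kG]_(dd_dim D l, dd_dim D kap)).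
Variables (T' : forall l kap : dual, 'M[kG]_(dd_dim D' kap, dd_dim D' l))
          (S' : forall l kap : dual, 'M[kG]_(dd_dim D' l, dd_dim D' kap)).
Hypotheses (xkTS : exchange_kernel T S) (xkTS' : exchange_kernel T' S').

(** The factor g^-1 corrects the change of subgroup: h g^-1 = g^-1 (g h g^-1) turns equivariance of
    T' under g K g^-1 into equivariance under K. *)
Definition transport l kap : 'M[kG]_(dd_dim D kap, dd_dim D l) :=
  (gelt g^-1%g)%:M *m (alg_mx (psi kap) *m T' l kap *m alg_mx (phi l)).

Lemma map_transport (B : algType k) (f : {lrmorphism kG -> B}) l kap :
  map_mx f (transport l kap) = (f (gelt g^-1%g))%:M *m
    (alg_mx (psi kap) *m map_mx f (T' l kap) *m alg_mx (phi l)).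
Proof. by rewrite !map_mxM map_scalar_mx !map_alg_mx. Qed.

Lemma transport_equivariant l kap : equivariant idfun (transport l kap).
Proof.
have [phiK psiK gD hpi] := isoDD'.
move=> h Dh; have [a a0 ea] := hpi h Dh; rewrite /=.
apply: (alg_mx_equivariantZ a0); rewrite !ea.
have gh : gelt h * gelt g^-1%g = gelt g^-1%g * gelt (g * h * g^-1)%g :> kG.
  by rewrite -!geltM !mulgA mulVg mul1g.
have := xk_equiv xkTS' l kap; rewrite /equivariant => /(_ (g * h * g^-1)%g).
rewrite gD => /(_ Dh); rewrite /= => eT'.
exact: sandwich_equivariant gh eT'.
Qed.

Lemma transport_weight l kap : transport l kap *m (Pproj (l - kap))%:M = transport l kap.
Proof.
rewrite /transport sandwich_scalar; congr (_ *m (_ *m _ *m _)).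
by apply/matrixP => i j; rewrite mul_mx_scalarE (xk_weight xkTS').
Qed.

(** Existence is surjectivity of T. Since the transported matrix absorbs P_(l - kap), t P_(l - kap)
    is also a solution, and uniqueness identifies it with t. *)
Lemma gauge_element l kap : exists t,
  [/\ has_weight idfun (l - kap) t, t * Pproj (l - kap) = t
    & T l kap *m t%:M = transport l kap].
Proof.
have [t wt] := kernel_surj xkTS (transport_equivariant l kap).
rewrite (map_mx_id (f := idfun) (fun=> erefl)) => e; exists t; split=> //.
apply: (kernel_inj1 char0 xkTS _ wt).
  by move=> a Aa /=; rewrite mulrA wt // scalerAl.
by rewrite scalar_mxM mulmxA e transport_weight.
Qed.

End Transport.

Section GaugeElement.
Variables (k : closedFieldType) (gT : finGroupType) (A : {group gT}).
Local Notation kG := (galg k gT).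
Local Notation dual := (dualgroup k A).
Hypothesis char0 : [pchar k] =i pred0.
Hypothesis abelA : abelian A.
Variable t : dual -> dual -> kG.
Hypothesis wt : forall l kap, has_weight idfun (l - kap) (t l kap).
Hypothesis tP : forall l kap, t l kap * Pproj (l - kap) = t l kap.

(** Each t(l, kap) lies in P k[G] P for P = P_(l - kap), so the sum is block diagonal: it commutes
    with A, and its blocks are recovered by multiplying with P on either side. *)
Definition gauge_sum l := \sum_kap t l kap.

Lemma gauge_sum_Pproj l kap : gauge_sum l * Pproj (l - kap) = t l kap.
Proof.
rewrite /gauge_sum mulr_suml (bigD1 kap) //= tP big1 ?addr0 // => kap' ne.
by rewrite -tP -mulrA Pproj_orth ?mulr0 // (can_eq (subKr l)).
Qed.

Lemma Pproj_gauge_sum l kap : Pproj (l - kap) * gauge_sum l = t l kap.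
Proof.
rewrite /gauge_sum mulr_sumr (bigD1 kap) //=.
have -> : Pproj (l - kap) * t l kap = t l kap.
  exact: (Pproj_weight char0 (phi := idfun) (@wt l kap)).
rewrite big1 ?addr0 // => kap' ne.
apply: (has_weight_disjoint (phi := idfun) (mu := l - kap) (nu := l - kap') 0 0) => //.
  exact: Pproj_gelt.
by rewrite (can_eq (subKr l)) eq_sym.
Qed.

Lemma gauge_sum_zero_weight l : zero_weight1 A (gauge_sum l).
Proof.
move=> a Aa; apply: (eq_on_Pproj char0 abelA) => mu; rewrite -[mu](subKr l).
rewrite -!mulrA gauge_sum_Pproj gelt_Pproj // -scalerAr gauge_sum_Pproj.
exact: wt.
Qed.

End GaugeElement.

Section Gauge.
Variables (k : closedFieldType) (gT : finGroupType) (A : {group gT}).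
Local Notation kG := (galg k gT).
Local Notation kGG := (galg k (gT * gT)%type).
Local Notation dual := (dualgroup k A).
Local Notation i1 := (@tens1_one k gT).
Local Notation i2 := (@one_tens1 k gT).
Local Notation Delta := (@comul k gT).
Local Notation cu := (@counit_unit k gT).
Local Notation P2 := (@Pproj2 k gT A).
Hypothesis char0 : [pchar k] =i pred0.
Hypothesis abelA : abelian A.
Variables D D' : dyn_datum k A.
Variables (g : gT) (phi : forall l, 'M[k]_(dd_dim D' l, dd_dim D l))
  (psi : forall l, 'M[k]_(dd_dim D l, dd_dim D' l)).
Hypothesis isoDD' : datum_iso g phi psi.
Variables (T : forall l kap : dual, 'M[kG]_(dd_dim D kap, dd_dim D l))
          (S : forall l kap : dual, 'M[kG]_(dd_dim D l, dd_dim D kap)).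
Variables (T' : forall l kap : dual, 'M[kG]_(dd_dim D' kap, dd_dim D' l))
          (S' : forall l kap : dual, 'M[kG]_(dd_dim D' l, dd_dim D' kap)).
Hypotheses (xkTS : exchange_kernel T S) (xkTS' : exchange_kernel T' S').
Hypotheses (normT : forall l, map_mx cu (T l l) = 1%:M)
  (normT' : forall l, map_mx cu (T' l l) = 1%:M).
Variables J J' : dual -> kGG.
Hypotheses (relJ : exchange_relation T J) (wtJ : exchange_weight J).
Hypotheses (relJ' : exchange_relation T' J') (wtJ' : exchange_weight J').

Variable t : dual -> dual -> kG.
Hypothesis wt : forall l kap, has_weight idfun (l - kap) (t l kap).
Hypothesis tP : forall l kap, t l kap * Pproj (l - kap) = t l kap.
Hypothesis Tt : forall l kap, T l kap *m (t l kap)%:M = transport g phi psi T' l kap.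
Local Notation tt := (gauge_sum t).

(** The counit kills every block except kap = l, and there the normalizations of T and T' force the
    value 1. *)
Lemma gauge_counit l : counit (tt l) = 1.
Proof.
have e : cu (tt l) = 1.
  have -> : cu (tt l) = cu (t l l).
    rewrite -(gauge_sum_Pproj tP) rmorphM /= subrr (counit_unit_Pproj char0) eqxx.
    by rewrite mulr1.
  have := congr1 (map_mx cu) (Tt l l).
  rewrite map_mxM normT mul1mx map_scalar_mx map_transport normT' mulmx1 -alg_mxM.
  have [_ -> _ _] := isoDD'; rewrite alg_mx1 mulmx1 /= counit_unit_gelt.
  (* As V_l is nonzero, an equality of scalar matrices can be read off at the entry (0, 0). *)
  have := dd_dim_gt0 D l; move: (dd_dim D l) => [//|n] _ /matrixP/(_ 0 0).
  by rewrite !mxE.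
have := congr1 (fun u => galg_coef u 1%g) e.
by rewrite counit_unitE galg_coefZ -gelt1 galg_coef_gelt eqxx mulr1.
Qed.

(** On P_nu (x) P_mu, both sides are the coefficient along T(l, tau) of the same matrix: the
    composite of T'(kap, tau) and T'(l, kap) transported to the modules of D. *)
Lemma gauge_intertwine l : comul (tt l) * J' l
  = J l * (\sum_(mu : dual) galg_tens (tt (l - mu)) (Pproj mu)) * one_tens1 (tt l).
Proof.
apply: (eq_on_Pproj2 char0 abelA) => nu mu.
pose kap := l - mu; pose tau := kap - nu.
have emu : mu = l - kap by rewrite subKr.
have enu : nu = kap - tau by rewrite subKr.
have wl : l - tau = mu + nu by rewrite emu enu addrA subrK.
(* Only the summand mu survives, and P2 can pass to the left of the blocks of t because they have
   matching left and right weights. *)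
have -> : J l * (\sum_(mu : dual) galg_tens (tt (l - mu)) (Pproj mu)) * one_tens1 (tt l)
    * P2 nu mu = J l * P2 nu mu * (i1 (t kap tau) * i2 (t l kap)).
  rewrite -!mulrA; congr (_ * _).
  rewrite [in RHS]mulrA; have -> : P2 nu mu * (i1 (t kap tau) * i2 (t l kap))
      = i1 (t kap tau) * i2 (t l kap).
    rewrite /Pproj2 tens1_mulM emu enu.
    by rewrite !(Pproj_weight char0 (phi := idfun) (@wt _ _)).
  rewrite mulr_suml (bigD1 mu) //= big1 ?addr0 => [|mu' ne].
    rewrite galg_tensE -/kap /Pproj2.
    rewrite -[i2 (tt l)]mul1r -(rmorph1 i1) !tens1_mulM mul1r emu enu.
    rewrite !(gauge_sum_Pproj tP); congr (_ * i2 _).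
    exact: (Pproj_weight char0 (phi := idfun) (@wt _ _)).
  rewrite galg_tensE -[i2 (tt l)]mul1r -(rmorph1 i1) /Pproj2 !tens1_mulM.
  rewrite emu (gauge_sum_Pproj tP) -(Pproj_weight char0 (phi := idfun) (@wt l kap)) /=.
  rewrite (mulrA (Pproj mu')) -emu.
  by rewrite Pproj_orth // mul0r raddf0 mulr0.
have -> : comul (tt l) * J' l * P2 nu mu = comul (t l tau) * (J' l * P2 nu mu).
  rewrite -(gauge_sum_Pproj tP) rmorphM -!mulrA /=; congr (_ * _).
  by rewrite wl (comul_Pproj_twist char0 wtJ').
apply: (kernel_inj char0 xkTS (phi := Delta) (l := l) (kap := tau)).
- move=> a Aa; rewrite mulrA -rmorphM /= wt // linearZ /=.
  by rewrite scalerAl.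
- move=> a Aa; rewrite -[J l * _ * _]mulrA (mulrA (Delta (gelt a))).
  rewrite (twist_comm char0 abelA wtJ) // -[J l * _ * _]mulrA (mulrA (Delta (gelt a))).
  by rewrite comul_Pproj2 // -scalerAl -scalerAr wl.
have [phiK psiK _ _] := isoDD'.
have mapT (B : algType k) (f : {lrmorphism kG -> B}) l' kap' :
    map_mx f (T l' kap') *m (f (t l' kap'))%:M = (f (gelt g^-1%g))%:M *m
    (alg_mx (psi kap') *m map_mx f (T' l' kap') *m alg_mx (phi l')).
  by rewrite -map_transport -Tt map_mxM map_scalar_mx.
rewrite (scalar_mxM _ (Delta (t l tau)) (J' l * P2 nu mu)) mulmxA (mapT _ Delta).
rewrite sandwich_scalar.
have -> : map_mx Delta (T' l tau) *m (J' l *  P2 nu mu)%:M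
  = map_mx i1 (T' kap tau) *m map_mx i2 (T' l kap) by rewrite relJ' -emu -enu.
(* Since Delta(g^-1) = g^-1 (x) g^-1, transporting the composite is the same as composing the
   transports. *)
rewrite /= comul_gelt -(sandwich_mul _ _ _ _ (phiK kap)); last first.
  by move=> i j; rewrite mxE; apply: tens1_one_comm.
rewrite -(mapT _ i1) -(mapT _ i2).
rewrite (scalar_mxM _ (J l * P2 nu mu)) (mulmxA (map_mx Delta (T l tau))).
rewrite {1}enu {1}emu -relJ.
have cT : map_mx i2 (T l kap) *m (i1 (t kap tau))%:M
    = (i1 (t kap tau))%:M *m map_mx i2 (T l kap).
  by apply: comm_mx_scalarl => i j; rewrite mxE; apply/commr_sym/tens1_one_comm.
by rewrite scalar_mxM -!mulmxA (mulmxA (map_mx i2 _)) cT -!mulmxA.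
Qed.

End Gauge.

Lemma gauge_element_family (k : closedFieldType) (gT : finGroupType) (A : {group gT})
    (char0 : [pchar k] =i pred0) (D D' : dyn_datum k A) g phi psi T S T' S' :
    datum_iso (D := D) (D' := D') g phi psi ->
    exchange_kernel T S -> exchange_kernel T' S' ->
  exists t : dualgroup k A -> dualgroup k A -> galg k gT,
    [/\ forall l kap, has_weight idfun (l - kap) (t l kap),
        forall l kap, t l kap * Pproj (l - kap) = t l kap
      & forall l kap, T l kap *m (t l kap)%:M = transport g phi psi T' l kap].
Proof.
move=> iso xk xk'.
have [t ht] := fin_all_exists (fun p : dualgroup k A * dualgroup k A =>
  gauge_element char0 iso xk xk' p.1 p.2).
by exists (fun l kap => t (l, kap)); split=> l kap; have [] := ht (l, kap).
Qed.

(** Transporting T' to the modules of D and back cancels g, [phi] and [psi], so T t t' = T = T P_(l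
    - kap), and uniqueness applies. *)
Lemma transport_gauge_inverse (k : closedFieldType) (gT : finGroupType) (A : {group gT})
    (char0 : [pchar k] =i pred0) (D D' : dyn_datum k A) g phi psi T S T'
    (t t' : dualgroup k A -> dualgroup k A -> galg k gT) :
    datum_iso (D := D) (D' := D') g phi psi -> exchange_kernel T S ->
    (forall l kap, has_weight idfun (l - kap) (t l kap)) ->
    (forall l kap, T l kap *m (t l kap)%:M = transport g phi psi T' l kap) ->
    (forall l kap, T' l kap *m (t' l kap)%:M = transport g^-1 psi phi T l kap) ->
  forall l kap, t l kap * t' l kap = Pproj (l - kap).
Proof.
move=> [phiK psiK _ _] xk wt ht ht' l kap.
apply: (kernel_inj1 char0 xk (l := l) (kap := kap)).
- by move=> a Aa /=; rewrite mulrA wt // scalerAl.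
- exact: gelt_Pproj.
have -> : T l kap *m (Pproj (l - kap))%:M = T l kap.
  by apply/matrixP => i j; rewrite mul_mx_scalarE (xk_weight xk).
rewrite scalar_mxM mulmxA ht {1}/transport sandwich_scalar ht' /transport invgK.
rewrite -!mulmxA (mulmxA (alg_mx (psi kap))) alg_mx_scalar -!mulmxA.
rewrite (mulmxA (gelt _)%:M (gelt _)%:M) -scalar_mxM -geltM mulVg mul1mx.
rewrite (mulmxA (alg_mx (psi kap))) -alg_mxM psiK alg_mx1 mul1mx.
by rewrite -alg_mxM psiK alg_mx1 mulmx1.
Qed.

Lemma gauge_sum_mul (k : closedFieldType) (gT : finGroupType) (A : {group gT})
    (char0 : [pchar k] =i pred0) (abelA : abelian A)
    (t t' : dualgroup k A -> dualgroup k A -> galg k gT) :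
    (forall l kap, t l kap * Pproj (l - kap) = t l kap) ->
    (forall l kap, has_weight idfun (l - kap) (t' l kap)) ->
    (forall l kap, t' l kap * Pproj (l - kap) = t' l kap) ->
    (forall l kap, t l kap * t' l kap = Pproj (l - kap)) ->
  forall l, gauge_sum t l * gauge_sum t' l = 1.
Proof.
move=> tP wt' tP' tt' l; apply: (eq_on_Pproj char0 abelA) => mu.
rewrite mul1r -[mu](subKr l) -mulrA (gauge_sum_Pproj tP').
rewrite -(Pproj_gauge_sum char0 wt') mulrA (gauge_sum_Pproj tP).
by rewrite -[t l _]tP -mulrA (Pproj_gauge_sum char0 wt') tt'.
Qed.

Lemma exchange_relation_gauge (k : closedFieldType) (gT : finGroupType) (A : {group gT})
    (char0 : [pchar k] =i pred0) (abelA : abelian A)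
    (D D' : dyn_datum k A) g phi psi T S T' S' J J' :
    datum_iso (D := D) (D' := D') g phi psi ->
    exchange_kernel (D := D) T S -> exchange_kernel (D := D') T' S' ->
    (forall l, map_mx (@counit_unit k gT) (T l l) = 1%:M) ->
    (forall l, map_mx (@counit_unit k gT) (T' l l) = 1%:M) ->
    exchange_relation (D := D) T J -> exchange_weight (A := A) J ->
    exchange_relation (D := D') T' J' -> exchange_weight (A := A) J' ->
  gauge_equivalent J J'.
Proof.
move=> iso xk xk' nT nT' rJ wJ rJ' wJ'.
have [t [wt tP ht]] := gauge_element_family char0 iso xk xk'.
have [t' [wt' tP' ht']] := gauge_element_family char0 (datum_iso_sym iso) xk' xk.
have tt' := transport_gauge_inverse char0 iso xk wt ht ht'.
have t't l kap : t' l kap * t l kap = Pproj (l - kap).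
  apply: (transport_gauge_inverse char0 (datum_iso_sym iso) xk' wt' ht').
  by rewrite invgK.
have U l : gauge_sum t l \is a GRing.unit.
  exact: falg_left_inverse_unit (gauge_sum_mul char0 abelA tP' wt tP t't l).
exists (gauge_sum t) => [l|l].
  split=> //; first exact: gauge_sum_zero_weight.
  exact: (gauge_counit char0 iso nT nT' tP ht).
have Ud : comul (gauge_sum t l) \is a GRing.unit by apply: rmorph_unit.
apply: (mulrI Ud); rewrite (gauge_intertwine char0 abelA iso xk rJ wJ rJ' wJ' wt tP ht).
by rewrite /gauge_act !mulrA -rmorphM mulrV // rmorph1 mul1r.
Qed.

(** * Normalization of the isomorphisms eps *)

Section Normalization.
Variables (k : closedFieldType) (gT : finGroupType) (A : {group gT}).
Local Notation kG := (galg k gT).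
Local Notation dual := (dualgroup k A).
Local Notation cu := (@counit_unit k gT).
Hypothesis char0 : [pchar k] =i pred0.
Variable D : dyn_datum k A.
Local Notation d := (dd_dim D).

Lemma triv_act (u : kG) : galg_act (triv_repr k gT) u = (counit u)%:M.
Proof.
rewrite /galg_act /counit raddf_sum; apply: eq_bigr => h _ /=.
by rewrite scale_scalar_mx mulr1.
Qed.

Lemma map_counit_unitE m n (X : 'M[kG]_(m, n)) (Y : 'M[k]_(m, n)) :
  map_mx cu X = alg_mx Y <-> forall i j, counit (X i j) = Y i j.
Proof.
split=> [/matrixP e i j|e]; last first.
  by apply/matrixP => i j; rewrite alg_mxE mxE counit_unitE e.
have := e i j; rewrite alg_mxE mxE counit_unitE => /(congr1 (fun u => galg_coef u 1%g)).
by rewrite !galg_coefZ -gelt1 galg_coef_gelt eqxx !mulr1.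
Qed.

Lemma eps_normalizedP (eps : eps_family D) :
  eps_normalized eps <-> forall l, map_mx cu (exch_mx eps l l) = 1%:M.
Proof.
have PsiT l i j : Psi eps (triv_repr k gT) l l 1%:M (mxtens_index (i, 0)) j
    = counit (exch_mx eps l l i j).
  by rewrite PsiE triv_act mulmx1 mxE eqxx mulr1n.
split=> [nrm l|nrm l v].
  rewrite -alg_mx1; apply/map_counit_unitE => i j; rewrite -PsiT.
  have := congr1 (fun M : 'M_(_, _) => M (mxtens_index (i, 0)) 0) (nrm l (delta_mx j 0)).
  by rewrite /= -colE mxE /tensmx mxE !mxtens_indexK !(ord1 (_ : 'I_1)) !mxE !eqxx andbT mulr1.
have cT i j : counit (exch_mx eps l l i j) = (1%:M : 'M[k]_(d l)) i j.
  by move: i j; apply/map_counit_unitE; rewrite alg_mx1 nrm.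
apply/matrixP => r a; case: (mxtens_indexP r) => i b; rewrite (ord1 b) mxE.
rewrite /tensmx [RHS]mxE !mxtens_indexK !(ord1 (_ : 'I_1)) [1%:M 0 0]mxE eqxx mulr1.
rewrite (bigD1 i) //= PsiT cT mxE eqxx mul1r big1 ?addr0 // => j ne.
by rewrite PsiT cT mxE eq_sym (negPf ne) mul0r.
Qed.

Lemma ind_iso_scale (K L : {group gT}) m n (rho : gT -> 'M[k]_m) (sigma : gT -> 'M[k]_n)
    (f : {linear ind K rho -> ind L sigma}) (c : k) :
  c != 0 -> ind_iso f -> ind_iso (c \*: f).
Proof.
move=> c0 [[f' fK f'K] fG]; split.
  exists (fun v => f' (c^-1 *: v)) => v /=; first by rewrite scalerK.
  by rewrite f'K scalerA mulfV // scale1r.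
move=> g v /=; rewrite fG; apply: ind_ext => x.
by rewrite ind_funZ !ind_fun_act ind_funZ.
Qed.

(* Applied to the identity of V_l, exactness of the kernel over the trivial
   module shows that Psi(l, 1) is a nonzero scalar, without Schur's lemma. *)
Lemma counit_exch_mx (eps : eps_family D) :
    (forall l kap, ind_iso (eps l kap)) ->
  forall l, exists2 z, z != 0 & forall i j,
    z * counit (exch_mx eps l l i j) = (i == j)%:R.
Proof.
move=> iso l; have [S xk] := exch_mx_kernel char0 iso.
have eq1 : equivariant cu (1%:M : 'M[kG]_(d l)).
  by move=> h Kh; rewrite /= counit_unit_gelt !mulmx1 mul1mx.
have := xk_section xk eq1; rewrite mulmx1.
pose z := \sum_q counit (S l l q q).
have -> : \tr (map_mx cu (S l l)) = z%:A.
  by rewrite /mxtrace scaler_suml; apply: eq_bigr => q _; rewrite mxE counit_unitE.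
move=> e.
have ez i j : z * counit (exch_mx eps l l i j) = (i == j)%:R.
  have := congr1 (fun M : 'M_(_, _) => galg_coef (M i j) 1%g) e.
  rewrite mul_mx_scalarE [map_mx _ _ _ _]mxE /= counit_unitE -scalerAl mul1r scalerA !mxE.
  rewrite galg_coefZ -gelt1 galg_coef_gelt eqxx mulr1 mulrC => ->.
  by case: eqP; rewrite ?galg_coef_gelt ?eqxx ?galg_coef0.
exists z => //; apply/eqP => z0.
have := dd_dim_gt0 D l; case: (d l) (exch_mx eps l l) ez => // n X ez _.
by have /eqP := ez 0 0; rewrite z0 mul0r eqxx eq_sym oner_eq0.
Qed.

(** Start from any isomorphisms eps; rescaling the diagonal ones eps_(l,l) by the scalar of
    [counit_exch_mx] achieves the normalization. *)
Lemma exchange_choice_ex : exists eps : eps_family D, exchange_choice eps.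
Proof.
pose Q l kap (f : {linear ind D (dd_hom D l kap) -> ind A (char_mx (l - kap))}) :=
  ind_iso f.
have ex l kap : exists f, Q l kap f.
  by have := dd_ind D l (l - kap); rewrite subKr.
have /fin_all_exists[eps0 iso0] : forall l, exists f, forall kap, Q l kap (f kap).
  by move=> l; apply: (fin_all_exists (P := Q l)).
have /fin_all_exists2[z z0 ez] := counit_exch_mx (eps := eps0) iso0.
pose eps : eps_family D := fun l kap => (if kap == l then z l else 1) \*: eps0 l kap.
exists eps; split.
  move=> l kap; apply: ind_iso_scale (iso0 l kap).
  by case: ifP => _; [apply: z0 | apply: oner_neq0].
apply/eps_normalizedP => l; rewrite -alg_mx1; apply/map_counit_unitE => i j.
rewrite !mxE /eps /= eqxx linearZ /= /counit.
under eq_bigr => h _ do rewrite galg_coefZ.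
rewrite -mulr_sumr; have := ez l i j; rewrite mxE => ->.
by case: eqP.
Qed.

End Normalization.

Lemma dd_isomorphic_datum_iso (k : closedFieldType) (gT : finGroupType) (A : {group gT})
    (D D' : dyn_datum k A) : dd_isomorphic D D' ->
  exists g phi psi, datum_iso (D := D) (D' := D') g phi psi.
Proof.
move=> [g [eD' [alpha /fin_all_exists[phi hphi]]]].
have /fin_all_exists[psi hpsi] : forall l, exists psi : 'M[k]_(dd_dim D l, dd_dim D' l),
    phi l *m psi = 1%:M /\ psi *m phi l = 1%:M.
  by move=> l; have [[psi e1 e2] _ _] := hphi l; exists psi.
exists g, phi, psi; split=> [l|l|h|h Dh]; try by have [] := hpsi l.
  rewrite -[_ \in dd_group D']/(_ \in (dd_group D' : {set gT})) -eD'.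
  apply: (mem_imset (f := fun h => (g * h * g^-1)%g)) => x y.
  by move/mulIg/mulgI.
(* Nonvanishing of the multiplier is read at l = 0, as alpha does not depend on l. *)
exists (alpha h) => [|l]; first by have [_ a0 _] := hphi 0; apply: a0.
have [_ psiK] := hpsi l; have [_ _ /(_ h Dh) e] := hphi l.
by rewrite -mulmxA e -scalemxAr mulmxA psiK mul1mx.
Qed.

(** The existence of admissible eps and of J keeps the claims about all choices from being vacuous.
    Applied to a datum and itself, the second half also shows that the gauge class is independent of
    eps. *)
Theorem theorem6p4 (k : closedFieldType) (gT : finGroupType) (A : {group gT})
    (char0 : [pchar k] =i pred0) (abelA : abelian A) :
  (forall D : dyn_datum k A,
     (exists eps : eps_family D, exchange_choice eps) /\
     (forall eps : eps_family D, exchange_choice eps ->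
        (exists J, is_exchange eps J) /\
        (forall J, is_exchange eps J -> dynamical_twist J))) /\
  (forall D D' : dyn_datum k A, dd_isomorphic D D' ->
     forall (eps : eps_family D) (eps' : eps_family D'),
       exchange_choice eps -> exchange_choice eps' ->
     forall J J', is_exchange eps J -> is_exchange eps' J' ->
       gauge_equivalent J J').
Proof.
split=> [D|D D' /dd_isomorphic_datum_iso[g [phi [psi iso]]] eps eps'].
  split=> [|eps [eiso /eps_normalizedP nrm]]; first exact: exchange_choice_ex.
  have [S xk] := exch_mx_kernel char0 eiso.
  split=> [|J hJ l].
    have [J [rJ wJ]] := exchange_relation_ex char0 xk.
    by exists J; apply: exchange_relation_is_exchange.
  have rJ := is_exchange_relation char0 hJ; have wJ := is_exchange_weight hJ.
  split.
  - exact: (twist_unit char0 xk nrm abelA rJ wJ).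
  - exact: (twist_zero_weight char0 abelA wJ).
  - exact: (twist_equation char0 abelA xk rJ wJ).
  - exact: (twist_counit_id char0 xk nrm abelA rJ wJ).
  - exact: (twist_id_counit char0 xk nrm abelA rJ wJ).
move=> [eiso /eps_normalizedP nrm] [eiso' /eps_normalizedP nrm'] J J' hJ hJ'.
have [S xk] := exch_mx_kernel char0 eiso; have [S' xk'] := exch_mx_kernel char0 eiso'.
apply: (exchange_relation_gauge char0 abelA iso xk xk' nrm nrm').
- exact: (is_exchange_relation char0 hJ).
- exact: (is_exchange_weight hJ).
- exact: (is_exchange_relation char0 hJ').
- exact: (is_exchange_weight hJ').
Qed.
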